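(* Let $M>0$, let $P_0$ be a distribution on $\mathbb{R}$ dominated by Lebesgue measure $\mu$, with density $p_0$, such that $-P_0\log(p_F/p_0)<\infty$ for some $F\in\mathscr{F}$, where $\mathscr{F}$ is the set of probability distributions on $[-M,M]$ and $p_F(x)=\int\phi(x-z)\,dF(z)$ with $\phi$ the standard normal density. Let $F^*\in\mathscr{F}$ be the (unique) minimizer of $F\mapsto-P_0\log(p_F/p_0)$ over $\mathscr{F}$, and assume that $p_0/p_{F^*}\in L_\infty(\mu)$. Let the prior $\Pi$ be a Dirichlet process distribution on $\mathscr{F}$ whose base measure $\alpha$ is a finite measure, supported on $[-M,M]$, with a positive, continuous Lebesgue density on $[-M,M]$. Then the posterior distribution concentrates its mass around $P_{F^*}$ asymptotically at the rate $\log n/\sqrt n$ relative to the distance $d$ given by $$d^2(P_{F_1},P_{F_2})=\frac12\int(\sqrt{p_{F_1}}-\sqrt{p_{F_2}})^2\,\frac{p_0}{p_{F^*}}\,d\mu;$$ that is, for any constants $K_n\to\infty$, $$\Pi_n\Bigl(F\in\mathscr{F}: d(P_F,P_{F^*})>K_n\frac{\log n}{\sqrt n}\,\Big|\,X_1,\ldots,X_n\Bigr)\to0\quad\text{in }P_0\text{-probability}.$$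
   Context: $X_1,\ldots,X_n$ are i.i.d. from $P_0$. $P_F$ is the distribution on $\mathbb{R}$ with Lebesgue density $p_F$, and $P_0f=\int f\,dP_0$. The posterior mass of a measurable $B\subset\mathscr{F}$ is $$\Pi_n(B|X_1,\ldots,X_n)=\int_B\prod_{i=1}^np_F(X_i)\,d\Pi(F)\Big/\int_{\mathscr{F}}\prod_{i=1}^np_F(X_i)\,d\Pi(F).$$ A Dirichlet process distribution with base measure $\alpha$ (a finite nonzero measure on $[-M,M]$) is the law of a random probability measure $F$ on $[-M,M]$ such that for every finite measurable partition $A_1,\ldots,A_k$ of $[-M,M]$, the vector $(F(A_1),\ldots,F(A_k))$ has the Dirichlet distribution with parameters $(\alpha(A_1),\ldots,\alpha(A_k))$. *)

(* Defs.v *)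
From HB Require Import structures.
From mathcomp Require Import all_boot all_order all_algebra finmap.
From mathcomp Require Import all_classical all_reals all_analysis.
Set Implicit Arguments.
Unset Strict Implicit.
Unset Printing Implicit Defensive.
Import Order.TTheory GRing.Theory Num.Theory.
Import numFieldNormedType.Exports.

Local Open Scope classical_set_scope.
Local Open Scope ring_scope.

(* Borel probability distributions on the real line, with the sigma-algebra
   generated by the evaluations F |-> F A, A Borel. *)
Notation distr R := (pprobability (measurableTypeR R) R).

Section probability_notions.
Context (R : realType) (d : measure_display) (Om : measurableType d).
Variable P : probability Om R.

Definition mutually_independent (I : choiceType) (Y : I -> {RV P >-> R}) :=
  forall (J : {fset I}) (B : I -> set R), (forall i, measurable (B i)) ->
    P (\bigcap_(i in [set` J]) (Y i @^-1` B i)) =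
    (\prod_(i <- J) P (Y i @^-1` B i))%E.

Definition iid (X : nat -> {RV P >-> R}) (P0 : distr R) :=
  mutually_independent X /\
  forall i (B : set R), measurable B -> distribution P (X i) B = P0 B.

Definition cvg_in_probability (Z : nat -> Om -> R) (l : R) :=
  forall eps : R, 0 < eps ->
    (fun n => P [set w | eps < `|Z n w - l|]) @ \oo --> 0%E.

End probability_notions.

Section dirichlet.
Context (R : realType).
Notation mu := (@lebesgue_measure R).

Definition gamma_fun (a : R) : R :=
  \int[mu]_(t in `]0, +oo[) (t `^ (a - 1) * expR (- t)).

(* Gamma distribution of shape a >= 0 and scale 1; shape 0 is the point mass
   at 0. *)
Definition gamma_law (a : R) (B : set R) : \bar R :=
  if a == 0 then \d_(0 : R) B
  else (\int[mu]_(t in B `&` `]0%R, +oo[)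
          (t `^ (a - 1) * expR (- t) / gamma_fun a)%:E)%E.

(* nu is the Dirichlet distribution with parameters a_i >= 0, not all zero:
   the law of (Y_1/S, ..., Y_k/S) with S = Y_1 + ... + Y_k for independent
   Y_i ~ Gamma(a_i, 1) (Ferguson 1973).  Zero parameters have to be allowed,
   because a cell of a partition may be null for the base measure. *)
Definition dirichlet_law (k : nat) (a : 'I_k -> R)
    (nu : set (k.-tuple R) -> \bar R) : Prop :=
  exists (d : measure_display) (Om : measurableType d) (Q : probability Om R)
         (Y : 'I_k -> {RV Q >-> R}),
    [/\ mutually_independent Y,
        forall i (B : set R), measurable B ->
          distribution Q (Y i) B = gamma_law (a i) B &
        forall B : set (k.-tuple R), measurable B ->
          nu B = pushforward Q
            (fun w => [tuple Y i w / \sum_(j < k) Y j w | i < k]) B].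

Definition distr_on (M : R) : set (distr R) :=
  [set F : distr R | F `[- M, M]%classic = 1%E].

Definition dirichlet_process (M : R) (alpha : set R -> \bar R)
    (Pi : probability (distr R) R) : Prop :=
  Pi (distr_on M) = 1%E /\
  forall (k : nat) (A : 'I_k -> set R),
    (forall i, measurable (A i)) -> trivIset [set: 'I_k] A ->
    \bigcup_i A i = `[- M, M]%classic ->
    dirichlet_law (fun i => fine (alpha (A i)))
      (pushforward Pi (fun F : distr R => [tuple fine (F (A i)) | i < k])).

End dirichlet.

Section mixtures.
Context (R : realType).
Notation mu := (@lebesgue_measure R).
Implicit Types F : distr R.

Definition has_density (P0 : distr R) (p0 : R -> R) : Prop :=
  [/\ measurable_fun [set: R] p0, forall x, 0 <= p0 x &
      forall A : set R, measurable A -> P0 A = (\int[mu]_(x in A) (p0 x)%:E)%E].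

Definition mix_pdf F (x : R) : R := \int[F]_z normal_pdf 0 1 (x - z).

(* The value at points where p0 vanishes is irrelevant: they are P0-null. *)
Definition kl_loss (P0 : distr R) (p0 : R -> R) F : \bar R :=
  (\int[P0]_x (- ln (mix_pdf F x / p0 x))%:E)%E.

Definition is_kl_minimizer (M : R) (P0 : distr R) (p0 : R -> R) (Fs : distr R) : Prop :=
  distr_on M Fs /\
  forall F, distr_on M F -> (kl_loss P0 p0 Fs <= kl_loss P0 p0 F)%E.

Definition weighted_hellinger (p0 : R -> R) (Fs F1 F2 : distr R) : R :=
  Num.sqrt (2^-1 * \int[mu]_x
    ((Num.sqrt (mix_pdf F1 x) - Num.sqrt (mix_pdf F2 x)) ^+ 2
     * (p0 x / mix_pdf Fs x))).

Definition likelihood (n : nat) (x : nat -> R) F : R :=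
  \prod_(i < n) mix_pdf F (x i).

Definition posterior (M : R) (Pi : probability (distr R) R) (n : nat)
    (x : nat -> R) (B : set (distr R)) : R :=
  (\int[Pi]_(F in B) likelihood n x F)
  / (\int[Pi]_(F in distr_on M) likelihood n x F).

End mixtures.

(* Main.v *)
(* Write r_F = p_F / p_F*.  Minimality of F* along the segments (1-t) F* + t F
   gives P0 r_F <= 1, hence P0 sqrt(r_F) <= 1 - d(P_F, P_F* )^2: the affinity of a
   single F over a sample of size n is at most exp(- n d^2).  Put L = ln n.  On
   the event |X_i| <= L (i < n), whose probability tends to 1 because p0 <= C p_F*
   has Gaussian tails, p_F(x) = phi(x) int exp(x z - z^2/2) dF(z) is determined, up
   to a factor 1 + 1/n, by O(L) moments of F known to a precision n^-c: expand
   exp(x z) in its Taylor series.  Two consequences.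
   - exp(O(L^2)) distributions G_j suffice to represent all F, so that by a union
     bound and Markov's inequality the likelihood ratio is, with high probability,
     at most e exp(- K_n^2 L^2) uniformly over { d > K_n L / sqrt n }.
   - By Caratheodory's theorem F* can be replaced by a distribution charging only
     O(L) cells of a mesh n^-c, and the Dirichlet prior gives mass at least
     exp(- O(L^2)) to the F whose cell masses are n^-c-close to it; this bounds the
     normalizing integral from below by exp(- O(L^2)) times the likelihood of F*.
   As K_n -> oo, the first bound beats the second. *)
Require Import Defs.
From HB Require Import structures.
From mathcomp Require Import all_boot all_order all_algebra finmap.
From mathcomp Require Import all_classical all_reals all_analysis.
From mathcomp Require Import measurable_realfun ess_sup_inf ring lra.
Set Implicit Arguments.
Unset Strict Implicit.
Unset Printing Implicit Defensive.
Import Order.TTheory GRing.Theory Num.Theory.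
Import numFieldNormedType.Exports.

Local Open Scope classical_set_scope.
Local Open Scope ring_scope.

(** * Densities and independence *)

(** The square root is what makes the distance appear: P0 r_F <= 1 alone bounds the mean likelihood
    ratio by 1 and yields no decay, whereas 2 d^2 = P0 (sqrt r_F - 1)^2 turns the same inequality
    into a deficit of d^2 for P0 sqrt r_F. A union bound over representatives suffices, without
    tests or entropy integrals, because the covering is multiplicative: a factor 1 + 1/n per
    observation changes the whole likelihood by at most e. Absolute precision n^-c of the moments
    gives such relative precision because, for |x| <= L, the Laplace factor int exp(x z - z^2/2)
    dF(z) is at least n^-M exp(- M^2/2). No such uniform control holds on the whole line, hence the
    truncation at L. Both exponents O(L^2) have one origin: O(L) parameters, each costing a factor
    exp(O(L)). The rate is the solution of n eps^2 = L^2. *)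

Lemma measurable_indic_comp (R : realType) (d1 d2 : measure_display)
    (T1 : measurableType d1) (T2 : measurableType d2) (phi : T1 -> T2) (B : set T2) :
  measurable B -> measurable_fun [set: T1] phi ->
  measurable_fun [set: T1] (fun x => \1_B (phi x) : R).
Proof. by move=> mB; apply: measurableT_comp; exact: measurable_indic. Qed.

Section weighted_change_of_variables.
Import HBNNSimple.
Local Open Scope ereal_scope.

(** One lemma for three uses: a change of density ([phi] the identity), the law of a random variable
    ([h] constant), and the replacement of one factor in an independent product ([h] the product of
    the others). Checking indicators is enough, by simple functions and monotone convergence. *)
Lemma ge0_integral_weighted_pushforward (R : realType) (d1 d2 : measure_display)
    (T1 : measurableType d1) (T2 : measurableType d2)
    (mu : {measure set T1 -> \bar R}) (nu : {measure set T2 -> \bar R})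
    (phi : T1 -> T2) (h : T1 -> R) (c : R) (f : T2 -> \bar R) :
  measurable_fun [set: T1] phi -> measurable_fun [set: T1] h -> (forall x, 0 <= h x)%R ->
  (0 <= c)%R ->
  (forall B, measurable B -> \int[mu]_x ((\1_B (phi x))%:E * (h x)%:E) = c%:E * nu B) ->
  measurable_fun [set: T2] f -> (forall y, 0 <= f y) ->
  \int[mu]_x (f (phi x) * (h x)%:E) = c%:E * \int[nu]_y f y.
Proof.
move=> mphi mh h0 c0 hB mf f0.
pose g := nnsfun_approx measurableT mf.
have mhE : measurable_fun setT (EFin \o h) by exact/measurable_EFinP.
have step n : \int[mu]_x ((g n (phi x))%:E * (h x)%:E) =
    \int[nu]_y (c%:E * (g n y)%:E).
  rewrite ge0_integralZl//; last 2 first.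
  - by apply/measurable_EFinP.
  - by move=> x _; rewrite lee_fin.
  rewrite integralT_nnsfun sintegralE.
  rewrite ge0_mule_fsumr//; last first.
    move=> y; have [yn|y0] := ltP y 0%R; last by rewrite mule_ge0.
    by rewrite preimage_nnfun0// measure0 mule0.
  transitivity (\int[mu]_x (\sum_(y \in range (g n))
      (y * \1_(g n @^-1` [set y]) (phi x))%:E * (h x)%:E)).
    apply: eq_integral => x _.
    rewrite -ge0_mule_fsuml; last by move=> y; exact: nnfun_muleindic_ge0.
    by rewrite fsumEFin// -(fimfunE _ (phi x)).
  rewrite ge0_integral_fsum//; last 2 first.
  - move=> y; apply: emeasurable_funM => //; apply/measurable_EFinP.
    apply: measurable_funM => //.
    exact: measurable_indic_comp.
  - by move=> y x _; rewrite mule_ge0 ?lee_fin// -lee_fin nnfun_muleindic_ge0.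
  apply: eq_fsbigr => y _.
  have [yn|y0] := ltP y 0%R.
    rewrite preimage_nnfun0// measure0 !mule0 integral0_eq// => x _.
    by rewrite indic0 mulr0 mul0e.
  rewrite muleCA -hB// -ge0_integralZl//; last 2 first.
  - apply: emeasurable_funM => //; apply/measurable_EFinP.
    exact: measurable_indic_comp.
  - by move=> x _; rewrite mule_ge0// lee_fin.
  by apply: eq_integral => x _; rewrite EFinM muleA.
rewrite -ge0_integralZl//.
have -> : \int[mu]_x (f (phi x) * (h x)%:E) =
    limn (fun n => \int[mu]_x ((g n (phi x))%:E * (h x)%:E)).
  rewrite -monotone_convergence//.
  - apply: eq_integral => x _; apply/esym/cvg_lim => //.
    by apply: cvgeZr => //; exact: cvg_nnsfun_approx.
  - move=> n; apply: emeasurable_funM => //; apply/measurable_EFinP.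
    exact: measurableT_comp.
  - by move=> n x _; rewrite mule_ge0// lee_fin.
  - move=> x _ a b ab; rewrite lee_wpmul2r ?lee_fin//.
    exact/lefP/nd_nnsfun_approx.
rewrite (_ : (fun n => _) = (fun n => \int[nu]_y (c%:E * (g n y)%:E))); last first.
  by apply/funext => n; exact: step.
rewrite -monotone_convergence//.
- apply: eq_integral => x _; apply/cvg_lim => //.
  by apply: cvgeZl => //; exact: cvg_nnsfun_approx.
- by move=> n; apply: measurable_funeM; apply/measurable_EFinP.
- by move=> n x _; rewrite mule_ge0// lee_fin.
- move=> x _ a b ab; rewrite lee_wpmul2l ?lee_fin//.
  exact/lefP/nd_nnsfun_approx.
Qed.

Lemma ge0_integral_density (R : realType) (d : measure_display)
    (T : measurableType d) (mu nu : {measure set T -> \bar R}) (h : T -> R)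
    (f : T -> \bar R) :
  measurable_fun [set: T] h -> (forall x, 0 <= h x)%R ->
  (forall A, measurable A -> nu A = \int[mu]_(x in A) (h x)%:E) ->
  measurable_fun [set: T] f -> (forall y, 0 <= f y) ->
  \int[nu]_y f y = \int[mu]_x (f x * (h x)%:E).
Proof.
move=> mh h0 nuE mf f0.
rewrite (ge0_integral_weighted_pushforward (c := 1%R) (nu := nu) (phi := id))//.
- by rewrite mul1e.
- move=> B mB; rewrite mul1e nuE// [RHS]integral_mkcond.
  apply: eq_integral => x _; rewrite patchE indicE.
  by case: ifPn => _; rewrite ?mul1e ?mul0e.
Qed.

End weighted_change_of_variables.

Section product_expectation.
Context (R : realType) (d : measure_display) (Om : measurableType d).
Variable P : probability Om R.
Local Open Scope ereal_scope.

Lemma mutually_independent_expectation_prod (X : nat -> {RV P >-> R})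
    (n : nat) (f : nat -> R -> R) :
  mutually_independent X ->
  (forall i, measurable_fun [set: R] (f i)) -> (forall i x, 0 <= f i x)%R ->
  (forall i, \int[P]_w (f i (X i w))%:E < +oo) ->
  \int[P]_w (\prod_(i < n) f i (X i w))%:E =
  \prod_(i < n) \int[P]_w (f i (X i w))%:E.
Proof.
move=> indep.
have mfX (g : R -> R) i : measurable_fun [set: R] g ->
    measurable_fun [set: Om] (fun w => g (X i w)).
  by move=> mg; exact: measurableT_comp.
(* Indicators are replaced by general functions one factor at a time: as functions
   of the set in the k-th indicator, both sides are measures. *)
suff : forall k, (k <= n)%N -> forall f : nat -> R -> R,
  (forall i, measurable_fun [set: R] (f i)) -> (forall i x, 0 <= f i x)%R ->
  (forall i, \int[P]_w (f i (X i w))%:E < +oo) ->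
  (forall i, (k <= i)%N -> exists2 B, measurable B & f i = \1_B) ->
  \int[P]_w (\prod_(i < n) f i (X i w))%:E =
  \prod_(i < n) \int[P]_w (f i (X i w))%:E.
  move=> H mf f0 foo.
  (* Factors of index at least n become the constant 1, an indicator, so that the induction
     statement applies at k = n. *)
  pose f' i := if (i < n)%N then f i else \1_setT.
  have f'E i : (i < n)%N -> f' i = f i by rewrite /f' => ->.
  have := H n (leqnn n) f'.
  under eq_integral do under eq_bigr do rewrite f'E//.
  under [in RHS]eq_bigr do rewrite f'E//.
  apply=> [i|i x|i|i]; rewrite /f'; case: ifPn => //.
  - move=> _; rewrite (eq_integral (cst 1)); last by move=> x _; rewrite indicT.
    by rewrite integral_cst//= probability_setT mule1 ltry.
  - by rewrite ltnNge => /negbTE ->.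
  - by move=> _ _; exists setT.
elim=> [_ {}f mf f0 foo fB|k IH kn {}f mf f0 foo fB].
  have {fB} [B fB] : exists B, forall i, measurable (B i) /\ f i = \1_(B i).
    have H i : exists B, measurable B /\ f i = \1_B.
      by have [B mB fiB] := fB i (leq0n i); exists B.
    by exists (fun i => projT1 (cid (H i))) => i; case: cid.
  have mB i : measurable (B i) by have [] := fB i.
  have JE (i : nat) : [set` seq_fset tt (iota 0 n)] i <-> (i < n)%N.
    by have := seq_fsetE tt (iota 0 n) i; rewrite mem_iota/= add0n => <-.
  have -> : \int[P]_w (\prod_(i < n) f i (X i w))%:E =
      P (\bigcap_(i in [set` seq_fset tt (iota 0 n)]) (X i @^-1` B i)).
    rewrite -[in RHS](setIT (\bigcap_(_ in _) _)) -integral_indic//; last first.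
      apply: bigcap_measurableType => i _.
      by rewrite -[X in measurable X]setTI; exact: measurable_funP.
    apply: eq_integral => w _; congr EFin.
    under eq_bigr do rewrite (fB _).2 indicE.
    rewrite indicE.
    have [/set_mem Hw|/negP Hw] := boolP (w \in _).
      rewrite big1// => i _; rewrite mem_set//.
      by apply: Hw; apply/JE.
    apply/eqP; rewrite prodf_seq_eq0; apply/hasP.
    apply: contrapT => H; apply: Hw; apply/mem_set => i /JE ilt.
    apply: contrapT => Hj; apply: H; exists (Ordinal ilt); rewrite ?mem_index_enum//=.
    by rewrite memNset.
  rewrite indep//.
  rewrite (perm_big (iota 0 n)); last first.
    by apply: perm_trans (seq_fset_perm tt _) _; rewrite undup_id ?iota_uniq.
  rewrite -[X in iota 0 X]subn0 -/(index_iota 0 n) big_mkord.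
  apply: eq_bigr => i _; rewrite (fB i).2.
  under eq_integral do rewrite -[\1_(B i) _]/((\1_(B i) \o X i) _).
  rewrite -[X in P X](setIT) -integral_indic//.
  by rewrite -[X in measurable X]setTI; exact: measurable_funP.
pose k' := Ordinal kn.
pose h w := (\prod_(i < n | i != k') f i (X i w))%R.
have h0 w : (0 <= h w)%R by apply: prodr_ge0.
have mh : measurable_fun [set: Om] h.
  rewrite /h; under eq_fun do rewrite -big_filter.
  by apply: measurable_prod => i _; exact: mfX.
pose c : \bar R := \prod_(i < n | i != k') \int[P]_w (f i (X i w))%:E.
have c0 : 0 <= c by apply: prode_ge0 => i _; apply: integral_ge0 => w _; rewrite lee_fin.
(* The hypothesis of finite expectations is spent here: it makes [c] a real scalar. *)
have cfin : c \is a fin_num.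
  rewrite /c; elim/big_ind : _ => //; first by move=> x y; exact: fin_numM.
  by move=> i _; rewrite ge0_fin_numE// integral_ge0// => w _; rewrite lee_fin.
have mfXk : measurable_fun [set: R] (fun y => (f k y)%:E) by exact/measurable_EFinP.
pose nu := distribution P (X k).
have E1 B : measurable B ->
  \int[P]_w ((\1_B (X k w))%:E * (h w)%:E) = (fine c)%:E * nu B.
  move=> mB.
  pose fB' i := if i == k then \1_B else f i.
  have ne (i : 'I_n) : (i != k') -> fB' i = f i.
    by rewrite /fB' -val_eqE/= => /negbTE ->.
  have fBk : fB' k = \1_B by rewrite /fB' eqxx.
  have -> : \int[P]_w ((\1_B (X k w))%:E * (h w)%:E) =
      \int[P]_w (\prod_(i < n) fB' i (X i w))%:E.
    apply: eq_integral => w _; rewrite (bigD1 k')//= fBk EFinM /h.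
    by congr (_ * _%:E)%E; apply: eq_bigr => i ik; rewrite ne.
  rewrite IH//; first last.
  - move=> i ki; rewrite /fB'; case: ifPn => [_|ik]; first by exists B.
    by apply: fB; rewrite ltn_neqAle eq_sym ik.
  - move=> i; rewrite /fB'; case: ifPn => // _.
    apply: (@le_lt_trans _ _ (\int[P]_w (cst 1 w))).
      apply: ge0_le_integral => //.
      + by apply/measurable_EFinP; exact: mfX.
      + by move=> w _; rewrite lee_fin indicE lern1 leq_b1.
    by rewrite integral_cst//= probability_setT mule1 ltry.
  - by move=> i x; rewrite /fB'; case: ifPn.
  - by move=> i; rewrite /fB'; case: ifPn.
  - exact: ltnW.
  rewrite (bigD1 k')//= fBk fineK// muleC; congr (_ * _).
    by apply: eq_bigr => i ik; rewrite ne.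
  rewrite (_ : nu B = P ((X k @^-1` B) `&` setT)); last by rewrite setIT.
  rewrite -(integral_indic P measurableT)//.
  by rewrite -[X in measurable X]setTI; exact: measurable_funP.
rewrite [RHS](bigD1 k')//= -/c.
transitivity (\int[P]_w ((f k (X k w))%:E * (h w)%:E)).
  by apply: eq_integral => w _; rewrite (bigD1 k')//= EFinM.
rewrite (ge0_integral_weighted_pushforward (f := fun y => (f k y)%:E)
  (c := fine c) (nu := nu) (measurable_funP (X k)) mh)//.
- by rewrite fineK// muleC ge0_integral_distribution// => y; rewrite lee_fin.
- by rewrite fine_ge0.
- by move=> y; rewrite lee_fin.
Qed.
End product_expectation.

(** * Measurability in the mixing distribution *)

(** The inverse is expressed through the measurable function [powR], which agrees with it only on
    nonnegative bases, hence the square. At a zero of f both sides are 0, by the convention 0^-1 =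
    0. *)
Lemma measurable_funV (R : realType) (d : measure_display)
    (T : measurableType d) (f : T -> R) :
  measurable_fun [set: T] f -> measurable_fun [set: T] (fun x => (f x)^-1).
Proof.
move=> mf; rewrite (_ : (fun _ => _) = (fun x => f x * (f x ^+ 2) `^ (-1))).
  apply: measurable_funM => //.
  exact: (measurableT_comp (measurable_powR (-1)) (measurable_funX 2 mf)).
apply/funext => x; rewrite powR_inv1 ?sqr_ge0//.
have [->|fx0] := eqVneq (f x) 0; first by rewrite mul0r invr0.
by rewrite expr2 invfM mulVKf.
Qed.

Section mixture_measurability.
Context (R : realType).
Notation mu := (@lebesgue_measure R).

Lemma normal_pdf01E (y : R) :
  normal_pdf 0 1 y = normal_peak 1 * expR (- y ^+ 2 / 2) :> R.
Proof.
by rewrite normal_pdfE ?oner_neq0// /normal_fun subr0 expr1n.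
Qed.

Lemma measurable_distr_eval (A : set R) : measurable A ->
  measurable_fun [set: distr R] (fun F : distr R => F A).
Proof.
move=> mA.
exact: (measurable_kernel (kprobability (@measurable_id _ (distr R) setT))).
Qed.

Lemma measurable_distr_on (M : R) : measurable (distr_on M : set (distr R)).
Proof.
have := measurable_distr_eval (measurable_itv `[- M, M]) measurableT.
move=> /(_ [set 1%E]); rewrite setTI; apply.
exact: emeasurable_set1.
Qed.

(** Measurability is needed jointly in F and x, since Tonelli is applied over x for the distance and
    over F for the posterior. The map (F, x) |-> F is a probability kernel, and integration against
    a kernel preserves measurability. *)
Lemma measurable_mix_pdf :
  measurable_fun [set: (distr R * R)%type]
    (fun p : (distr R * R)%type => mix_pdf p.1 p.2).
Proof.
rewrite /mix_pdf /Rintegral.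
apply: measurableT_comp => //.
pose k : R.-fker (distr R * measurableTypeR R)%type ~> measurableTypeR R :=
  kprobability (@measurable_fst _ _ (distr R) (measurableTypeR R)).
pose f (q : (distr R * measurableTypeR R) * measurableTypeR R) : \bar R := (normal_pdf 0 1 (q.1.2 - q.2))%:E.
apply: (measurable_fun_integral_finite_kernel f k).
- by move=> z; rewrite lee_fin normal_pdf_ge0.
- apply/measurable_EFinP; apply: measurableT_comp.
    exact: measurable_normal_pdf.
  apply: measurable_funB; last exact: measurable_snd.
  exact: (measurableT_comp measurable_snd measurable_fst).
Qed.

Lemma measurable_mix_pdf_section (F : distr R) : measurable_fun [set: R] (mix_pdf F).
Proof.
exact: (measurableT_comp measurable_mix_pdf (measurable_pair1 F)).
Qed.

Lemma mix_pdf_ge0 (F : distr R) (x : R) : 0 <= mix_pdf F x.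
Proof. by apply: Rintegral_ge0 => z _; exact: normal_pdf_ge0. Qed.

Lemma measurable_weighted_hellinger (p0 : R -> R) (Fs : distr R) :
  measurable_fun [set: R] p0 -> (forall x, 0 <= p0 x) ->
  measurable_fun [set: distr R] (fun F => weighted_hellinger p0 Fs F Fs).
Proof.
move=> mp0 p00; rewrite /weighted_hellinger /Rintegral.
have msqrt : measurable_fun [set: R] (@Num.sqrt R).
  by apply: continuous_measurable_fun; exact: sqrt_continuous.
apply: measurableT_comp => //.
apply: measurable_funM => //.
apply: measurableT_comp => //.
pose f (q : (distr R * measurableTypeR R)%type) : \bar R :=
  ((Num.sqrt (mix_pdf q.1 q.2) - Num.sqrt (mix_pdf Fs q.2)) ^+ 2
     * (p0 q.2 / mix_pdf Fs q.2))%:E.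
apply: (measurable_fun_fubini_tonelli_F (m2 := mu) f).
- apply/measurable_EFinP; apply: measurable_funM.
    apply: measurable_funX; apply: measurable_funB.
      exact: (measurableT_comp msqrt measurable_mix_pdf).
    apply: (measurableT_comp msqrt).
    exact: (measurableT_comp (measurable_mix_pdf_section Fs) measurable_snd).
  apply: measurable_funM.
    exact: (measurableT_comp mp0 measurable_snd).
  apply: measurable_funV.
  exact: (measurableT_comp (measurable_mix_pdf_section Fs) measurable_snd).
- move=> q; rewrite lee_fin mulr_ge0 ?sqr_ge0// divr_ge0//.
  exact: mix_pdf_ge0.
Qed.

Lemma measurable_integral_likelihood (Pi : probability (distr R) R)
    (d : measure_display) (Om : measurableType d) (P : probability Om R)
    (X : nat -> {RV P >-> R}) (n : nat) (B : set (distr R)) : measurable B ->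
  measurable_fun [set: Om]
    (fun w => \int[Pi]_(F in B) likelihood n (fun i => X i w) F).
Proof.
move=> mB; rewrite /Rintegral.
apply: measurableT_comp => //.
under eq_fun do rewrite integral_mkcond.
pose f (q : (Om * distr R)%type) : \bar R :=
  ((fun F => (likelihood n (fun i => X i q.1) F)%:E) \_ B) q.2.
apply: (measurable_fun_fubini_tonelli_F (m2 := Pi) f).
- rewrite /f.
  rewrite (_ : (fun _ => _) = (fun q => (likelihood n (fun i => X i q.1) q.2)%:E * (\1_B q.2)%:E)%E); last first.
    apply/funext => q; rewrite patchE indicE; case: ifPn => _.
      by rewrite mule1.
    by rewrite mule0.
  apply: emeasurable_funM; apply/measurable_EFinP; last first.
    by apply: measurable_indic_comp => //; exact: measurable_snd.
  apply: measurable_prod => i _.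
  pose g (q : (Om * distr R)%type) : (distr R * R)%type := (q.2, X i q.1).
  have mg : measurable_fun [set: (Om * distr R)%type] g.
    apply: measurable_fun_pair; first exact: measurable_snd.
    exact: (measurableT_comp (measurable_funP (X i)) measurable_fst).
  exact: (measurableT_comp measurable_mix_pdf mg).
- move=> q; rewrite /f patchE; case: ifPn => // _.
  by rewrite lee_fin; apply: prodr_ge0 => i _; exact: mix_pdf_ge0.
Qed.

End mixture_measurability.

(** * Mixtures with close moments *)

Section exponential_taylor.
Context (R : realType).

Lemma ler_sum_expR (x : R) (K : nat) : 0 <= x ->
  \sum_(k < K) x ^+ k / k`!%:R <= expR x.
Proof.
move=> x0; rewrite -(big_mkord xpredT (fun k => x ^+ k / k`!%:R)).
apply: (nondecreasing_cvgn_le (u_ := series (exp_coeff x))).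
- apply/nondecreasing_seqP => n; rewrite /series/= big_nat_recr//= lerDl.
  exact: exp_coeff_ge0.
- exact: is_cvg_series_exp_coeff.
Qed.

(** Exponential weighting of the tail: for k >= K, |x|^k is at most e^-K (e |x|)^k, and the weighted
    series sums to at most exp(e |x|). *)
Lemma expR_taylor_tail (x : R) (K : nat) :
  `|expR x - \sum_(k < K) x ^+ k / k`!%:R| <= expR (expR 1 * `|x| - K%:R).
Proof.
have H : `|series (exp_coeff x) m - \sum_(k < K) x ^+ k / k`!%:R| @[m --> \oo]
    --> `|expR x - \sum_(k < K) x ^+ k / k`!%:R|.
  apply: cvg_norm; apply: cvgB; last exact: cvg_cst.
  exact: is_cvg_series_exp_coeff.
rewrite -(cvg_lim _ H)//; apply: limr_le; first by apply/cvg_ex; eexists; exact: H.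
exists K => // m /= Km.
rewrite /series/= (@big_cat_nat _ _ _ K)//= big_mkord addrAC subrr add0r.
apply: le_trans (ler_norm_sum _ _ _) _.
rewrite expRB ler_pdivlMr ?expR_gt0//.
apply: le_trans (ler_sum_expR m _); last by rewrite mulr_ge0// expR_ge0.
rewrite -(big_mkord xpredT (fun k => (expR 1 * `|x|) ^+ k / k`!%:R)).
rewrite [leRHS](@big_cat_nat _ _ _ K)//= mulr_suml ler_wpDl//.
  by apply: sumr_ge0 => k _; rewrite divr_ge0// exprn_ge0// mulr_ge0// expR_ge0.
apply: ler_sum_nat => k /andP[Kk _].
rewrite /exp_coeff /= normrM normrV ?unitfE ?pnatr_eq0 -?lt0n ?fact_gt0// normrX.
rewrite (@ger0_norm _ k`!%:R)// exprMn mulrC -[leRHS]mulrA ler_wpM2r//.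
by rewrite -expRM_natl mulr1 ler_expR ler_nat.
Qed.

End exponential_taylor.

Section gaussian_mixture.
Context (R : realType) (M : R).
Hypothesis M_gt0 : 0 < M.
Notation D := `[- M, M]%classic.
Implicit Types F G : distr R.

Lemma integrable_bounded (F : distr R) (A : set R) (f : R -> R) (C : R) :
  measurable A -> measurable_fun A f -> (forall z, A z -> `|f z| <= C) ->
  F.-integrable A (EFin \o f).
Proof.
move=> mA mf fC; apply: measurable_bounded_integrable => //.
  by rewrite (le_lt_trans (probability_le1 F mA))// ltry.
exists C; split; first exact: num_real.
by move=> y Cy z Az /=; rewrite (le_trans (fC z Az))// ltW.
Qed.

Lemma abs_itv (z : R) : D z -> `|z| <= M.
Proof. by rewrite /= in_itv/= ler_norml. Qed.

Lemma distr_on_fine F : distr_on M F -> fine (F D) = 1.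
Proof. by rewrite /distr_on/= => ->. Qed.

Lemma le_distr_on_Rintegral F (f : R -> R) (C : R) : distr_on M F ->
  measurable_fun D f -> (forall z, D z -> `|f z| <= C) ->
  `|\int[F]_(z in D) f z| <= C.
Proof.
move=> FM mf fC.
have iF : F.-integrable D (EFin \o f) by exact: integrable_bounded fC.
apply: le_trans (le_normr_Rintegral _ iF) _ => //.
have -> : C = \int[F]_(z in D) (cst C z).
  by rewrite Rintegral_cst// distr_on_fine// mulr1.
apply: le_Rintegral => //.
- by apply: (@integrable_bounded _ _ _ C) => // [|z Dz]; [exact: measurableT_comp|rewrite normr_id fC].
- by apply: (@integrable_bounded _ _ _ `|C|).
Qed.

Lemma ge_distr_on_Rintegral F (f : R -> R) (c C : R) : distr_on M F ->
  measurable_fun D f -> (forall z, D z -> c <= f z <= C) ->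
  c <= \int[F]_(z in D) f z.
Proof.
move=> FM mf fC.
have -> : c = \int[F]_(z in D) (cst c z).
  by rewrite Rintegral_cst// distr_on_fine// mulr1.
apply: le_Rintegral => //.
- by apply: (@integrable_bounded _ _ _ `|c|).
- apply: (@integrable_bounded _ _ _ (`|c| + `|C|)) => // z Dz.
  have /andP[cf fC'] := fC z Dz.
  rewrite ler_norml; apply/andP; split.
    apply: le_trans cf; rewrite lerNl (le_trans (ler_norm _))// normrN.
    by rewrite lerDl.
  by apply: le_trans fC' _; rewrite (le_trans (ler_norm _))// lerDr.
- by move=> z /fC /andP[].
Qed.

Lemma Rintegral_lincomb F (K : nat) (c : nat -> R) (f : nat -> R -> R) (C : R) :
  (forall k, measurable_fun D (f k)) ->
  (forall k z, D z -> `|f k z| <= C) ->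
  \int[F]_(z in D) (\sum_(k < K) c k * f k z) =
  \sum_(k < K) c k * \int[F]_(z in D) f k z.
Proof.
move=> mf fC.
have ifk k : F.-integrable D (EFin \o f k).
  by apply: (@integrable_bounded _ _ _ C) => // z; exact: fC.
elim: K => [|K IH].
  by under eq_Rintegral do rewrite big_ord0; rewrite big_ord0 Rintegral_cst// mul0r.
under eq_Rintegral do rewrite big_ord_recr/=.
rewrite big_ord_recr/= RintegralD//.
- by rewrite IH RintegralZl.
- apply: (@integrable_bounded _ _ _ (\sum_(k < K) `|c k| * C)) => //.
    by apply: measurable_sum => k; exact: measurable_funM.
  move=> z Dz; apply: le_trans (ler_norm_sum _ _ _) _; apply: ler_sum => k _.
  by rewrite normrM ler_wpM2l// fC.
- apply: (@integrable_bounded _ _ _ (`|c K| * C)) => //.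
    exact: measurable_funM.
  by move=> z Dz; rewrite normrM ler_wpM2l// fC.
Qed.

(* With this normalization the moments lie in [-1, 1] and
   [exp (x z - z^2 / 2) = \sum_k (M x)^k / k! * moment_fun k z]. *)
Definition moment_fun (k : nat) (z : R) : R := (z / M) ^+ k * expR (- z ^+ 2 / 2).
Definition gauss_moment (k : nat) F : R := \int[F]_(z in D) moment_fun k z.
Definition gauss_laplace F (x : R) : R :=
  \int[F]_(z in D) expR (x * z - z ^+ 2 / 2).

Lemma measurable_moment_fun k : measurable_fun D (moment_fun k).
Proof.
apply: measurable_funTS; apply: measurable_funM.
  by apply: measurable_funX; exact: measurable_funM.
apply: measurableT_comp => //; apply: measurable_funM => //.
by apply: measurableT_comp => //; exact: measurable_funX.
Qed.

Lemma measurable_laplace_fun (x : R) :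
  measurable_fun D (fun z : R => expR (x * z - z ^+ 2 / 2)).
Proof.
apply: measurable_funTS; apply: measurableT_comp => //.
apply: measurable_funB; first exact: measurable_funM.
by apply: measurable_funM => //; exact: measurable_funX.
Qed.

Lemma moment_fun_le1 k z : D z -> `|moment_fun k z| <= 1.
Proof.
move=> /abs_itv zM; rewrite normrM normrX mulr_ile1//.
- rewrite exprn_ile1// normrM normfV (gtr0_norm M_gt0).
  by rewrite ler_pdivrMr// mul1r.
- rewrite ger0_norm ?expR_ge0// -expR0 ler_expR mulNr oppr_le0.
  by rewrite divr_ge0// sqr_ge0.
Qed.

Lemma laplace_fun_bounds (x z : R) : D z ->
  expR (- `|x| * M - M ^+ 2 / 2) <= expR (x * z - z ^+ 2 / 2) <= expR (`|x| * M).
Proof.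
move=> /abs_itv zM; rewrite !ler_expR; apply/andP; split.
- rewrite lerD//.
    rewrite mulNr lerNl (le_trans (ler_norm _))// normrN normrM.
    by rewrite ler_wpM2l.
  rewrite lerN2 ler_wpM2r ?invr_ge0//.
  by rewrite -[z ^+ 2]ger0_norm ?sqr_ge0// normrX lerXn2r ?nnegrE// ltW.
- rewrite lerBlDr (le_trans (ler_norm _))// normrM (@le_trans _ _ (`|x| * M))//.
    by rewrite ler_wpM2l.
  by rewrite lerDl divr_ge0// sqr_ge0.
Qed.

Lemma gauss_laplace_ge F x : distr_on M F ->
  expR (- `|x| * M - M ^+ 2 / 2) <= gauss_laplace F x.
Proof.
move=> FM; apply: (@ge_distr_on_Rintegral _ _ _ (expR (`|x| * M))) => //.
  exact: measurable_laplace_fun.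
exact: laplace_fun_bounds.
Qed.

Lemma gauss_laplace_le F x : distr_on M F -> gauss_laplace F x <= expR (`|x| * M).
Proof.
move=> FM; apply: le_trans (ler_norm _) _; apply: le_distr_on_Rintegral => //.
  exact: measurable_laplace_fun.
by move=> z Dz; rewrite ger0_norm ?expR_ge0//; have /andP[] := laplace_fun_bounds x Dz.
Qed.

Lemma mix_pdfE F x : distr_on M F ->
  mix_pdf F x = normal_peak 1 * expR (- x ^+ 2 / 2) * gauss_laplace F x.
Proof.
move=> FM; rewrite /mix_pdf /gauss_laplace -RintegralZl//; last first.
  apply: (@integrable_bounded _ _ _ (expR (`|x| * M))) => //.
    exact: measurable_laplace_fun.
  by move=> z Dz; rewrite ger0_norm ?expR_ge0//; have /andP[] := laplace_fun_bounds x Dz.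
rewrite /Rintegral; congr fine.
have mD : measurable (D : set R) by [].
have mn : measurable_fun [set: R] (fun z : R => (normal_pdf 0 1 (x - z))%:E).
  apply/measurable_EFinP; apply: measurableT_comp; first exact: measurable_normal_pdf.
  exact: measurable_funB.
(* [mix_pdf] integrates over the whole line; the integrands differ only off [- M, M], an F-null
   set. *)
rewrite [RHS]integral_mkcond; apply: ae_eq_integral => //.
  apply/(measurable_restrictT _ _).1 => //.
  apply/measurable_EFinP; apply: measurable_funM => //; exact: measurable_laplace_fun.
exists (~` D); split.
- exact: measurableC.
- by have := probability_setC F mD; rewrite (FM : F D = 1%E) subee.
- move=> z /= H Dz; apply: H => _; rewrite patchE mem_set//; congr EFin.
  rewrite normal_pdf01E -mulrA -expRD; congr (_ * expR _).
  by field.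
Qed.

Lemma mix_pdf_gt0 F x : distr_on M F -> 0 < mix_pdf F x.
Proof.
move=> FM; rewrite mix_pdfE// mulr_gt0 ?mulr_gt0 ?expR_gt0 ?normal_peak_gt0 ?oner_neq0//.
by apply: lt_le_trans (gauss_laplace_ge x FM); exact: expR_gt0.
Qed.

Lemma gauss_laplace_taylor F (x T : R) (K : nat) : distr_on M F -> `|x| <= T ->
  `|gauss_laplace F x - \sum_(k < K) (M * x) ^+ k / k`!%:R * gauss_moment k F|
    <= expR (expR 1 * (M * T) - K%:R).
Proof.
move=> FM xT.
rewrite -(Rintegral_lincomb F K (fun k => (M * x) ^+ k / k`!%:R)
  measurable_moment_fun moment_fun_le1).
rewrite -RintegralB//; first last.
- apply: (@integrable_bounded _ _ _ (\sum_(k < K) `|(M * x) ^+ k / k`!%:R| * 1)) => //.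
    by apply: measurable_sum => k; apply: measurable_funM => //; exact: measurable_moment_fun.
  move=> z Dz; apply: le_trans (ler_norm_sum _ _ _) _; apply: ler_sum => k _.
  by rewrite normrM ler_wpM2l// moment_fun_le1.
- apply: (@integrable_bounded _ _ _ (expR (`|x| * M))) => //.
    exact: measurable_laplace_fun.
  by move=> z Dz; rewrite ger0_norm ?expR_ge0//; have /andP[] := laplace_fun_bounds x Dz.
apply: le_distr_on_Rintegral => //.
  apply: measurable_funB; first exact: measurable_laplace_fun.
  by apply: measurable_sum => k; apply: measurable_funM => //; exact: measurable_moment_fun.
move=> z Dz.
have -> : expR (x * z - z ^+ 2 / 2) - \sum_(k < K) (M * x) ^+ k / k`!%:R * moment_fun k z
  = expR (- z ^+ 2 / 2) * (expR (x * z) - \sum_(k < K) (x * z) ^+ k / k`!%:R).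
  rewrite mulrBr -expRD; congr (expR _ - _); first by rewrite mulNr addrC.
  rewrite mulr_sumr; apply: eq_bigr => k _; rewrite /moment_fun mulrA.
  rewrite mulrC mulNr; congr (_ * _); rewrite mulrAC -exprMn; congr (_ ^+ _ * _).
  by field; exact: lt0r_neq0.
rewrite normrM -[leRHS]mul1r ler_pM//.
  rewrite ger0_norm ?expR_ge0// -expR0 ler_expR mulNr oppr_le0.
  by rewrite divr_ge0// sqr_ge0.
apply: le_trans (expR_taylor_tail _ _) _; rewrite ler_expR lerD2r ler_wpM2l ?expR_ge0//.
rewrite normrM mulrC ler_pM//; exact: abs_itv.
Qed.

(** The first term sums eta (M T)^k / k! over the retained moments; the second is the Taylor
    remainder, paid once for F and once for G. *)
Lemma gauss_laplace_close F G (x T eta : R) (K : nat) :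
  distr_on M F -> distr_on M G -> `|x| <= T -> 0 <= eta ->
  (forall k, (k < K)%N -> `|gauss_moment k F - gauss_moment k G| <= eta) ->
  `|gauss_laplace F x - gauss_laplace G x|
    <= eta * expR (M * T) + 2 * expR (expR 1 * (M * T) - K%:R).
Proof.
move=> FM GM xT eta0 FG.
have HF := gauss_laplace_taylor K FM xT.
have HG := gauss_laplace_taylor K GM xT.
set c := fun k : nat => (M * x) ^+ k / k`!%:R in HF HG.
have Hc : `|\sum_(k < K) c k * gauss_moment k F - \sum_(k < K) c k * gauss_moment k G|
    <= eta * expR (M * T).
  rewrite -sumrB; under eq_bigr do rewrite -mulrBr.
  apply: le_trans (ler_norm_sum _ _ _) _.
  apply: (@le_trans _ _ (\sum_(k < K) `|c k| * eta)).
    by apply: ler_sum => k _; rewrite normrM ler_wpM2l// FG.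
  rewrite -mulr_suml mulrC ler_wpM2l//.
  apply: (@le_trans _ _ (\sum_(k < K) (M * T) ^+ k / k`!%:R)); last first.
    by apply: ler_sum_expR; rewrite mulr_ge0// ?(ltW M_gt0)// (le_trans _ xT).
  apply: ler_sum => k _; rewrite /c normrM normrX normfV [X in _ / X]ger0_norm//.
  rewrite ler_wpM2r ?invr_ge0// lerXn2r ?nnegrE//.
    by rewrite mulr_ge0 ?(ltW M_gt0)// (le_trans _ xT).
  by rewrite normrM (gtr0_norm M_gt0) ler_wpM2l// ltW.
set hF := gauss_laplace F x in HF *; set hG := gauss_laplace G x in HG *.
set sF := \sum_(k < K) _ in HF Hc; set sG := \sum_(k < K) _ in HG Hc.
rewrite (_ : hF - hG = (sF - sG) + ((hF - sF) - (hG - sG))); last by ring.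
apply: le_trans (ler_normD _ _) _; rewrite lerD//.
apply: le_trans (ler_normB _ _) _; rewrite mulr_natl mulr2n lerD//.
Qed.

(** The absolute error becomes relative because the Laplace factor of G is at least exp(- T M -
    M^2/2) on |x| <= T. *)
Lemma mix_pdf_close F G (x T eta rho : R) (K : nat) :
  distr_on M F -> distr_on M G -> `|x| <= T -> 0 <= eta -> 
  (forall k, (k < K)%N -> `|gauss_moment k F - gauss_moment k G| <= eta) ->
  eta * expR (M * T) + 2 * expR (expR 1 * (M * T) - K%:R)
    <= rho * expR (- T * M - M ^+ 2 / 2) ->
  mix_pdf F x <= (1 + rho) * mix_pdf G x.
Proof.
move=> FM GM xT eta0 FG Hrho.
have H := le_trans (gauss_laplace_close FM GM xT eta0 FG) Hrho.
have rho0 : 0 <= rho by rewrite -(pmulr_lge0 _ (expR_gt0 (- T * M - M ^+ 2 / 2))) (le_trans _ H).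
rewrite !mix_pdfE// mulrCA; apply: ler_wpM2l.
  by rewrite mulr_ge0 ?expR_ge0 ?normal_peak_ge0.
rewrite mulrDl mul1r -lerBlDl (le_trans (ler_norm _))// (le_trans H)// ler_wpM2l//.
apply: le_trans (gauss_laplace_ge x GM); rewrite ler_expR lerD2r ler_wpM2r ?(ltW M_gt0)//.
by rewrite lerN2.
Qed.

Lemma mix_pdf_le F x : distr_on M F ->
  mix_pdf F x <= normal_peak 1 * expR (- x ^+ 2 / 2 + M * `|x|).
Proof.
move=> FM; rewrite mix_pdfE// expRD mulrA ler_wpM2l//.
  by rewrite mulr_ge0 ?expR_ge0 ?normal_peak_ge0.
by rewrite mulrC gauss_laplace_le.
Qed.

Lemma mix_pdf_ge F x : distr_on M F ->
  normal_peak 1 * expR (- x ^+ 2 / 2 - M * `|x| - M ^+ 2 / 2) <= mix_pdf F x.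
Proof.
move=> FM; rewrite mix_pdfE// -addrA expRD mulrA ler_wpM2l//.
  by rewrite mulr_ge0 ?expR_ge0 ?normal_peak_ge0.
by have := gauss_laplace_ge x FM; rewrite mulNr (mulrC `|x|).
Qed.

End gaussian_mixture.

(** * Gamma and Dirichlet laws *)

Section gamma_bounds.
Context (R : realType).
Notation mu := (@lebesgue_measure R).

Lemma powR_continuous (b x : R) : 0 < x -> {for x, continuous (@powR R ^~ b)}.
Proof.
move=> x0; apply/differentiable_continuous/derivable1_diffP.
by apply: derivable_powR; rewrite in_itv/= andbT.
Qed.

(** The fundamental theorem of calculus is applied away from 0, where the integrand is singular if a
    < 1; the bound does not depend on e, so e can tend to 0. *)
Lemma integral_powR_itv (a e : R) : 0 < a -> 0 < e -> e < 1 ->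
  (\int[mu]_(t in `[e, 1%R]) (t `^ (a - 1))%R%:E <= (a^-1)%:E)%E.
Proof.
move=> a0 e0 e1.
have cont b x : e <= x -> {for x, continuous (@powR R ^~ b)}.
  by move=> ex; apply: powR_continuous; exact: lt_le_trans ex.
have pos (x : R) : x \in `]e, 1[ -> x \in `]0, +oo[.
  by rewrite !in_itv/= andbT => /andP[+ _]; exact: lt_trans.
rewrite (@continuous_FTC2 _ _ (fun t => a^-1 * t `^ a) e 1)//.
- by rewrite -EFinB lee_fin powR1 mulr1 lerBlDr lerDl mulr_ge0 ?invr_ge0 ?powR_ge0// ltW.
- apply: continuous_in_subspaceT => x; rewrite inE/= in_itv/= => /andP[ex _].
  exact: cont.
- split.
  + by move=> x /pos x0; apply: derivableM => //; exact: derivable_powR.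
  + apply: cvg_at_right_filter; apply: cvgM; first exact: cvg_cst.
    exact: cont.
  + apply: cvg_at_left_filter; apply: cvgM; first exact: cvg_cst.
    by apply: cont; exact: ltW.
- move=> x /pos x0; rewrite derive1E deriveM//=; last exact: derivable_powR.
  rewrite derive_cst scaler0 addr0 -derive1E powR_derive1//.
  by rewrite /GRing.scale/= mulKf// gt_eqF.
Qed.

Lemma integral_powR01 (a : R) : 0 < a ->
  (\int[mu]_(t in `]0%R, 1%R]) (t `^ (a - 1))%R%:E <= (a^-1)%:E)%E.
Proof.
move=> a0.
pose F (n : nat) : set R := `[n.+2%:R^-1, 1]%classic.
have UF : \bigcup_n F n = `]0, 1]%classic.
  apply/seteqP; split => x.
    move=> [n _]; rewrite /F/= !in_itv/= => /andP[nx ->]; rewrite andbT.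
    by apply: lt_le_trans nx; rewrite invr_gt0.
  rewrite /= in_itv/= => /andP[x0 x1]; exists (Num.truncn x^-1) => //.
  rewrite /F/= in_itv/= x1 andbT invf_ple ?posrE//.
  apply: ltW; apply: lt_trans (truncnS_gt _) _.
  by rewrite ltr_nat ltnSn.
have mF (i : nat) : measurable (F i) by exact: measurable_itv.
have mf D : measurable_fun D (fun t : R => (t `^ (a - 1))%:E).
  by apply/measurable_EFinP; apply: measurable_funTS; exact: measurable_powR.
have HC : nondecreasing_seq F.
  move=> m n mn; apply/subsetPset => x; rewrite /F/= !in_itv/= => /andP[mx ->].
  by rewrite andbT (le_trans _ mx)// lef_pV2 ?posrE// ler_nat.
have H : (\int[mu]_(t in F i) (t `^ (a - 1))%:E @[i --> \oo] -->
    \int[mu]_(t in \bigcup_i F i) (t `^ (a - 1))%:E)%E.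
  apply: ge0_nondecreasing_set_cvg_integral => // i.
    by apply/measurable_EFinP; apply: measurable_funTS; exact: measurable_powR.
  by move=> x _; rewrite lee_fin powR_ge0.
rewrite UF in H; rewrite -(cvg_lim _ H)//; apply: lime_le.
  by apply/cvg_ex; eexists; exact: H.
apply: nearW => n; apply: integral_powR_itv => //.
by rewrite invf_lt1// ltr1n.
Qed.

(** This is ln u <= u at u = t / (2 A): half of the exponential absorbs the power. *)
Lemma powR_expRN_le (A t : R) : 0 < A -> 0 < t ->
  t `^ A * expR (- t) <= (2 * A) `^ A * expR (- (t / 2)).
Proof.
move=> A0 t0; rewrite /powR !gt_eqF ?mulr_gt0// -!expRD ler_expR.
have A2 : 0 < 2 * A by rewrite mulr_gt0.
have : ln (t / (2 * A)) <= t / (2 * A).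
  by apply/ltW/ln_sublinear; rewrite divr_gt0.
rewrite ln_div ?posrE// -(ler_pM2l A0) => H.
have : A * (t / (2 * A)) = t / 2 by field; rewrite gt_eqF.
by move: H => /[swap] ->; rewrite mulrBr; lra.
Qed.

(** The term 1/a bounds the integral over ]0, 1], the other one the tail, where int exp(- t/2)
    contributes the factor 2. What matters is the growth as a -> 0, that is for small cells: only
    like 1/a. *)
Definition gamma_fun_bound (A a : R) : R := a^-1 + 2 * (2 * A) `^ A.

Lemma integral_gamma_fun_le (A a : R) : 1 <= A -> 0 < a -> a <= A ->
  (\int[mu]_(t in `]0%R, +oo[) (t `^ (a - 1) * expR (- t))%:E
    <= (gamma_fun_bound A a)%:E)%E.
Proof.
move=> A1 a0 aA; have A0 : 0 < A by apply: lt_le_trans A1.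
have mp b D : measurable_fun D (fun t : R => (t `^ b)%:E).
  by apply/measurable_EFinP; apply: measurable_funTS; exact: measurable_powR.
have mg D : measurable_fun D (fun t : R => (t `^ (a - 1) * expR (- t))%:E).
  apply/measurable_EFinP; apply: measurable_funTS; apply: measurable_funM.
    exact: measurable_powR.
  by apply: measurableT_comp => //; exact: measurable_funN.
have m1 : measurable (`]0%R, 1%R] : set R) by [].
have m2 : measurable (`]1%R, +oo[ : set R) by [].
have -> : `]0%R, +oo[%classic = `]0%R, 1%R] `|` `]1%R, +oo[ :> set R.
  by rewrite -itv_bndbnd_setU ?bnd_simp.
rewrite ge0_integral_setU//; first last.
- rewrite disj_set2E; apply/eqP; rewrite -subset0 => x /= [].
  by rewrite !in_itv/= andbT => /andP[_ x1]; rewrite ltNge x1.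
- by move=> x _; rewrite lee_fin mulr_ge0 ?powR_ge0 ?expR_ge0.
- exact: mg.
rewrite /gamma_fun_bound EFinD; apply: leeD.
  apply: le_trans (integral_powR01 a0).
  apply: ge0_le_integral => //.
  - by move=> x _; rewrite lee_fin mulr_ge0 ?powR_ge0 ?expR_ge0.
  - exact: mg.
  - exact: mp.
  - move=> x; rewrite /= in_itv/= => /andP[x0 _]; rewrite lee_fin.
    rewrite ler_piMr ?powR_ge0// -expR0 ler_expR; lra.
apply: (@le_trans _ _ (\int[mu]_(t in `]1%R, +oo[)
   ((2 * (2 * A) `^ A)%:E * (exponential_pdf 2^-1 t)%:E))%E).
  apply: ge0_le_integral => //.
  - by move=> x _; rewrite lee_fin mulr_ge0 ?powR_ge0 ?expR_ge0.
  - exact: mg.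
  - apply: measurable_funeM; apply/measurable_EFinP; apply: measurable_funTS.
    by apply: measurable_exponential_pdf.
  - move=> x; rewrite /= in_itv/= andbT => x1.
    have x0 : 0 < x by apply: lt_trans x1.
    rewrite -EFinM lee_fin exponential_pdfE ?(ltW x0)//.
    apply: (@le_trans _ _ (x `^ A * expR (- x))).
      rewrite ler_wpM2r ?expR_ge0// ler_powR ?(ltW x1)//; lra.
    apply: le_trans (powR_expRN_le A0 x0) _.
    rewrite mulrACA divff// ?mul1r ?ler_wpM2l ?powR_ge0// ler_expR; lra.
rewrite ge0_integralZl//; first last.
- by rewrite lee_fin mulr_ge0 ?powR_ge0.
- by move=> x _; rewrite lee_fin exponential_pdf_ge0.
- apply/measurable_EFinP; apply: measurable_funTS.
  by apply: measurable_exponential_pdf.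
rewrite -[leRHS]mule1 lee_wpmul2l ?lee_fin ?mulr_ge0 ?powR_ge0//.
rewrite -(@integral_exponential_pdf R 2^-1)//.
apply: ge0_subset_integral => //.
- by apply/measurable_EFinP; apply: measurable_exponential_pdf.
- by move=> x _; rewrite lee_fin exponential_pdf_ge0.
Qed.

Lemma gamma_fun_le (A a : R) : 1 <= A -> 0 < a -> a <= A ->
  gamma_fun a <= gamma_fun_bound A a.
Proof.
move=> A1 a0 aA; rewrite -lee_fin; apply: le_trans (integral_gamma_fun_le A1 a0 aA).
rewrite /gamma_fun /Rintegral fineK// ge0_fin_numE.
  by apply: le_lt_trans (integral_gamma_fun_le A1 a0 aA) _; rewrite ltry.
by apply: integral_ge0 => x _; rewrite lee_fin mulr_ge0 ?powR_ge0 ?expR_ge0.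
Qed.

Lemma gamma_fun_ge0 (a : R) : 0 <= gamma_fun a.
Proof.
by apply: Rintegral_ge0 => x _; rewrite mulr_ge0 ?powR_ge0 ?expR_ge0.
Qed.

(* Total mass 1 is assumed to exclude the junk case [gamma_fun a = 0], in which the
   division in [gamma_law] gives the null measure. *)
Lemma gamma_law_itv_ge (A a w delta : R) : 1 <= A -> 0 < a -> a <= A ->
  0 <= w <= 1 -> 0 < delta <= 1 -> gamma_law a setT = 1%E ->
  (((delta / 2) `^ (A + 1) * expR (- 2) / gamma_fun_bound A a)%:E
    <= gamma_law a `[w, (w + delta)%R])%E.
Proof.
move=> A1 a0 aA /andP[w0 w1] /andP[d0 d1] mass.
have A0 : 0 < A by apply: lt_le_trans A1.
have G0 : 0 < gamma_fun a.
  rewrite lt_neqAle gamma_fun_ge0 andbT eq_sym; apply/negP => /eqP G0.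
  move: mass; rewrite /gamma_law gt_eqF// G0 invr0.
  under eq_integral do rewrite mulr0.
  by rewrite integral0 => /eqP; rewrite eq_sym onee_eq0.
rewrite /gamma_law gt_eqF//.
have mg D : measurable_fun D
    (fun t : R => (t `^ (a - 1) * expR (- t) / gamma_fun a)%:E).
  apply/measurable_EFinP; apply: measurable_funTS; apply: measurable_funM => //.
  apply: measurable_funM.
    exact: measurable_powR.
  by apply: measurableT_comp => //; exact: measurable_funN.
have g0 (x : R) : (0 <= (x `^ (a - 1) * expR (- x) / gamma_fun a)%:E)%E.
  by rewrite lee_fin !mulr_ge0 ?powR_ge0 ?expR_ge0 ?invr_ge0 ?gamma_fun_ge0.
(* The right half of the interval has t >= delta/2 even if w = 0. Its length delta/2 raises the
   exponent from A to A + 1. *)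
have sub : `[w + delta / 2, w + delta] `<=` `[w, w + delta] `&` `]0%R, +oo[.
  move=> x; rewrite /= !in_itv/= => /andP[x1 x2]; split; lra.
apply: (@le_trans _ _ (\int[mu]_(t in `[(w + delta / 2)%R, (w + delta)%R])
    (t `^ (a - 1) * expR (- t) / gamma_fun a)%:E)%E); last first.
  apply: ge0_subset_integral => //; first exact: measurableI.
  exact: mg.
pose c := (delta / 2) `^ A * expR (- 2) / gamma_fun_bound A a.
have cE : (delta / 2) `^ (A + 1) * expR (- 2) / gamma_fun_bound A a = c * (delta / 2).
  rewrite /c powRD; last by rewrite (gt_eqF (addr_gt0 A0 ltr01)).
  rewrite powRr1; last lra.
  by ring.
rewrite cE.
have -> : (c * (delta / 2))%:E = (\int[mu]_(t in `[(w + delta / 2)%R, (w + delta)%R]) cst c%:E t)%E.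
  rewrite integral_cst//= lebesgue_measure_itv/= ifT; last by rewrite lte_fin; lra.
  by rewrite -EFinB -EFinM; congr (_ * _)%:E; lra.
have c0 : 0 <= c.
  rewrite !mulr_ge0 ?powR_ge0 ?expR_ge0 ?invr_ge0//.
  by rewrite /gamma_fun_bound addr_ge0 ?invr_ge0 ?(ltW a0)// mulr_ge0 ?powR_ge0.
apply: ge0_le_integral => //.
  exact: mg.
move=> x; rewrite /= in_itv/= => /andP[x1 x2]; rewrite lee_fin.
have x0 : 0 < x by lra.
have x2' : x <= 2 by lra.
apply: ler_pM.
- by rewrite mulr_ge0 ?powR_ge0 ?expR_ge0.
- by rewrite invr_ge0 (le_trans (gamma_fun_ge0 a))// gamma_fun_le.
- apply: ler_pM; rewrite ?powR_ge0 ?expR_ge0//; last by rewrite ler_expR; lra.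
  have dd : 0 < delta / 2 by lra.
  (* The sign of a - 1 is unknown, so the powers are compared through logarithms, with ln x between
     ln(delta/2) and ln 2 and ln(delta/2) <= - ln 2. *)
  rewrite /powR !gt_eqF// ler_expR.
  have lnd : ln (delta / 2) <= - ln 2.
    rewrite -lnV ?posrE// ler_ln ?posrE ?invr_gt0//; lra.
  have ln20 : 0 <= ln 2 :> R by rewrite ln_ge0// ler1n.
  have lnx : ln x <= ln 2 by rewrite ler_ln ?posrE.
  have lndx : ln (delta / 2) <= ln x by rewrite ler_ln ?posrE//; lra.
  by nra.
- by rewrite lef_pV2 ?posrE ?gamma_fun_le// (lt_le_trans G0)// gamma_fun_le.
Qed.

End gamma_bounds.

Section dirichlet_small_ball.
Context (R : realType).

Lemma dirichlet_small_ball (k : nat) (a w : 'I_k -> R)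
    (nu : set (k.-tuple R) -> \bar R) (delta g : R) :
  dirichlet_law a nu -> (forall i, 0 <= w i) -> \sum_(i < k) w i = 1 ->
  0 < delta -> k%:R * delta <= 1 -> 0 <= g ->
  (forall i, gamma_law (a i) setT = 1%E ->
    (g%:E <= gamma_law (a i) `[w i, (w i + delta)%R])%E) ->
  ((g ^+ k)%:E <=
    nu [set t | forall i, (`|tnth t i - w i| <= k%:R * delta)%R])%E.
Proof.
move=> [d [Om [Q [Y [indep law nuE]]]]] w0 w1 d0 kd g0 gle.
have mB : measurable [set t : k.-tuple R | forall i, `|tnth t i - w i| <= k%:R * delta].
  rewrite (_ : [set t | _] = \bigcap_(i in [set: 'I_k])
      [set t : k.-tuple R | `|tnth t i - w i| <= k%:R * delta]); last first.
    by apply/seteqP; split => [t H i _|t H i]; apply: H.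
  apply: fin_bigcap_measurable => // i _.
  have mt : measurable_fun [set: k.-tuple R] (fun t => `|tnth t i - w i|).
    apply: measurableT_comp => //; apply: measurable_funB => //.
    exact: measurable_tnth.
  rewrite (_ : [set t | _] = (fun t => `|tnth t i - w i|) @^-1` `]-oo, (k%:R * delta)]).
    by rewrite -[X in measurable X]setTI; exact: mt.
  by apply/seteqP; split => t /=; rewrite in_itv.
rewrite nuE// /pushforward.
pose B i : set R := `[w i, w i + delta]%classic.
pose E := \bigcap_(i in [set: 'I_k]) (Y i @^-1` B i).
have mY i : measurable (Y i @^-1` B i).
  by rewrite -[X in measurable X]setTI; apply: measurable_funP => //; exact: measurable_itv.
have mE : measurable E by apply: fin_bigcap_measurable.
(* If every [Y i] lies in [[w i, w i + delta]], then so does their sum in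
   [[1, 1 + k delta]], and the normalized vector is [k delta]-close to [w]. *)
have QE : Q E = (\prod_(i < k) Q (Y i @^-1` B i))%E.
  have := indep (seq_fset tt (enum 'I_k)) B (fun i => measurable_itv _).
  rewrite (perm_big (enum 'I_k)) ?big_enum/=; last first.
    by apply: perm_trans (seq_fset_perm tt _) _; rewrite undup_id ?enum_uniq.
  move=> <-; congr (Q _); rewrite /E (_ : [set: 'I_k] = [set` seq_fset tt (enum 'I_k)])//.
  apply/seteqP; split => // i _.
  by have : i \in seq_fset tt (enum 'I_k) by rewrite seq_fsetE mem_enum.
(* The premise of [gle] holds because [gamma_law (a i)] is the law of the random variable [Y i]. *)
have mass i : gamma_law (a i) setT = 1%E.
  by rewrite -law// /distribution/pushforward preimage_setT probability_setT.
have gE : ((g ^+ k)%:E <= Q E)%E.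
  rewrite QE -[k in leLHS]card_ord -prodr_const -prodEFin.
  suff : (0 <= \prod_(i < k) g%:E <= \prod_(i < k) Q (Y i @^-1` B i))%E.
    by move=> /andP[].
  elim/big_rec2: _ => [|i x y _ /andP[y0 yx]]; first by rewrite lee01 lexx.
  rewrite mule_ge0 ?lee_fin//= lee_pmul//.
  by have := gle i (mass i); rewrite -law.
apply: le_trans gE _.
have mT : measurable_fun [set: Om]
    (fun o => [tuple Y i o / \sum_(j < k) Y j o | i < k]).
  apply/measurable_fun_tnthP => i.
  rewrite (_ : _ \o _ = (fun o => Y i o / \sum_(j < k) Y j o)); last first.
    by apply/funext => o /=; rewrite tnth_mktuple.
  apply: measurable_funM; first exact: measurable_funP.
  apply: measurable_funV; apply: measurable_sum => j; exact: measurable_funP.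
apply: le_measure; rewrite ?inE//.
  by rewrite -[X in measurable X]setTI; exact: mT.
move=> o Eo i; rewrite tnth_mktuple.
have HY j : w j <= Y j o <= w j + delta.
  by have := Eo j I; rewrite /B/= in_itv.
set S := \sum_(j < k) Y j o.
have S1 : 1 <= S by rewrite -w1; apply: ler_sum => j _; have /andP[] := HY j.
have S2 : S <= 1 + k%:R * delta.
  apply: (@le_trans _ _ (\sum_(j < k) (w j + delta))).
    by apply: ler_sum => j _; have /andP[] := HY j.
  by rewrite big_split/= w1 sumr_const card_ord mulr_natl.
have /andP[Yi1 Yi2] := HY i.
have S0 : 0 < S by apply: lt_le_trans S1.
have wi1 : w i <= 1.
  by rewrite -w1 (bigD1 i)//= lerDl; apply: sumr_ge0.
have dk : delta <= k%:R * delta.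
  by rewrite ler_peMl ?(ltW d0)// ler1n (leq_ltn_trans _ (ltn_ord i)).
have kd0 : 0 <= k%:R * delta by apply: le_trans dk; exact: ltW.
rewrite ler_distl; apply/andP; split.
  rewrite ler_pdivlMr//.
  have : (w i - k%:R * delta) * S <= w i; last by move=> /le_trans; apply.
  have [wk|wk] := leP 0 (w i - k%:R * delta); last first.
    by apply: le_trans (w0 i); rewrite pmulr_lle0// ltW.
  apply: (@le_trans _ _ ((w i - k%:R * delta) * (1 + k%:R * delta))).
    by rewrite ler_wpM2l.
  by have := w0 i; set t := k%:R * delta in kd0 *; nra.
rewrite ler_pdivrMr//.
apply: (@le_trans _ _ ((w i + k%:R * delta) * 1)); first by lra.
by rewrite ler_wpM2l// addr_ge0.
Qed.

End dirichlet_small_ball.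

(** * Prior mass of moment balls *)

(** Induction on the size of the support: more than D vectors are linearly dependent, and the
    weights are moved along a dependence until one of them vanishes. In this conic form the total
    mass is kept by adding a coordinate constantly equal to 1. *)
Lemma conic_caratheodory (R : realFieldType) (I : finType) (D : nat)
    (v : I -> 'rV[R]_D) (w : I -> R) : (forall i, 0 <= w i) ->
  exists w' : I -> R, [/\ forall i, 0 <= w' i,
    \sum_i w' i *: v i = \sum_i w i *: v i & (#|[set i | w' i != 0%R]%SET| <= D)%N].
Proof.
have [n] := ubnP #|[set i | w i != 0]%SET|; elim: n w => // n IH w Sn w0.
set S := [set i | w i != 0]%SET in Sn *.
have [SD|DS] := leqP #|S| D; first by exists w.
have [i0 i0S] : exists i0, i0 \in S by apply/card_gt0P; exact: leq_ltn_trans DS.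
pose A : 'M[R]_(#|S|, D) := \matrix_(j < #|S|) v (enum_val j).
have kA : kermx A != 0.
  rewrite kermx_eq0; apply/negP => /eqP rA.
  by have := rank_leq_col A; rewrite rA leqNgt DS.
pose c := nz_row (kermx A).
have cA : c *m A = 0 by apply/sub_kermxP; exact: nz_row_sub.
have c0 : c != 0 by rewrite nz_row_eq0.
pose cI i := if i \in S then c 0 (enum_rank_in i0S i) else 0.
have cIv : \sum_i cI i *: v i = 0.
  rewrite -[RHS]cA mulmx_sum_row (bigID (mem S))/= [X in _ + X]big1 ?addr0; last first.
    by move=> i /negbTE iS; rewrite /cI iS scale0r.
  rewrite big_enum_val/=; apply: eq_bigr => j _.
  by rewrite rowK /cI enum_valP enum_valK_in.
(* The dependence may have no positive coefficient; multiplying it by one of its nonzero entries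
   creates one. *)
have [b [i1 bpos]] : exists b : R, exists i1, 0 < b * cI i1.
  have [j cj] : exists j, c 0 j != 0.
    apply/existsP; apply: contraR c0 => /existsPn H.
    by apply/eqP/rowP => j; rewrite mxE; apply/eqP; rewrite -[_ == _]negbK H.
  exists (c 0 j), (enum_val j).
  by rewrite /cI enum_valP enum_valK_in -expr2 exprn_even_gt0.
pose e i := b * cI i.
have eS i : e i != 0 -> w i != 0.
  by rewrite /e /cI; case: ifPn => [|_]; rewrite ?inE// mulr0 eqxx.
have [i2 e2 i2min] : exists2 i2, 0 < e i2 & forall i, 0 < e i -> w i2 / e i2 <= w i / e i.
  by case: (@arg_minP _ _ _ i1 (fun i => 0 < e i) (fun i => w i / e i) bpos) => i2 e2 H; exists i2.
(* The largest step that keeps all weights nonnegative; it annihilates the weight of [i2]. *)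
pose t := w i2 / e i2.
have t0 : 0 <= t by rewrite divr_ge0// ltW.
pose w' i := w i - t * e i.
have w'0 i : 0 <= w' i.
  rewrite subr_ge0; have [ei|ei] := ltP 0 (e i).
    by rewrite -ler_pdivlMr// i2min.
  by apply: le_trans (w0 i); rewrite mulr_ge0_le0.
have [|//|w'' [w''0 w''v w''S]] := IH w'.
  rewrite ltnS in Sn; apply: leq_trans Sn; apply: proper_card; apply/properP; split.
    apply/fintype.subsetP => i; rewrite !inE; apply: contraNneq => wi.
    rewrite /w' wi sub0r oppr_eq0 mulf_eq0; apply/orP; right.
    by apply/negPn/negP => /eS; rewrite wi eqxx.
  exists i2; rewrite !inE; first by apply: eS; rewrite gt_eqF.
  by rewrite negbK /w' /t divfK ?subrr// gt_eqF.
exists w''; split => //; rewrite w''v.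
rewrite /w'; under eq_bigr do rewrite scalerBl.
rewrite sumrB [X in _ - X](_ : _ = 0) ?subr0//.
transitivity ((t * b) *: \sum_i cI i *: v i); last by rewrite cIv scaler0.
by rewrite scaler_sumr; apply: eq_bigr => i _; rewrite scalerA /e mulrA.
Qed.

Lemma expR_lipschitz (R : realType) (a b : R) : a <= 0 -> b <= 0 ->
  `|expR a - expR b| <= `|a - b|.
Proof.
wlog ab : a b / a <= b.
  move=> H a0 b0; have [ab|/ltW ba] := leP a b; first exact: H.
  by rewrite distrC [leRHS]distrC; exact: H.
move=> a0 b0; rewrite distrC [leRHS]distrC !ger0_norm ?subr_ge0 ?ler_expR//.
have -> : expR b - expR a = expR b * (1 - expR (a - b)).
  by rewrite mulrBr mulr1 -expRD subrKC.
have H : 1 - expR (a - b) <= b - a by have := expR_ge1Dx (a - b); lra.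
apply: le_trans H; rewrite ler_piMl//.
  by rewrite subr_ge0 -expR0 ler_expR subr_le0.
by rewrite -expR0 ler_expR.
Qed.

Section discretization.
Context (R : realType) (M : R).
Hypothesis M_gt0 : 0 < M.
Notation D := `[- M, M]%classic.
Implicit Types F G : distr R.

Lemma moment_fun_lipschitz (k : nat) (y z : R) : D y -> D z ->
  `|moment_fun M k y - moment_fun M k z| <= (k%:R / M + M) * `|y - z|.
Proof.
move=> Dy Dz.
have nM x : D x -> `|x / M| <= 1.
  by move=> /abs_itv xM; rewrite normrM normfV (gtr0_norm M_gt0) ler_pdivrMr// mul1r.
have Hp : `|(y / M) ^+ k - (z / M) ^+ k| <= k%:R / M * `|y - z|.
  rewrite subrXX normrM -mulrBl normrM normfV (gtr0_norm M_gt0).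
  rewrite (_ : k%:R / M * _ = `|y - z| * M^-1 * k%:R); last by ring.
  rewrite ler_wpM2l ?mulr_ge0 ?invr_ge0 ?(ltW M_gt0)//.
  apply: le_trans (ler_norm_sum _ _ _) _.
  rewrite -[k in leRHS]card_ord -sumr_const; apply: ler_sum => i _.
  by rewrite normrM !normrX mulr_ile1 ?exprn_ge0 ?exprn_ile1 ?nM.
have sq0 (x : R) : - x ^+ 2 / 2 <= 0.
  by rewrite mulNr oppr_le0 divr_ge0// sqr_ge0.
have He : `|expR (- y ^+ 2 / 2) - expR (- z ^+ 2 / 2)| <= M * `|y - z|.
  apply: le_trans (expR_lipschitz (sq0 y) (sq0 z)) _.
  rewrite (_ : _ - _ = - ((y + z) / 2) * (y - z)); last by field.
  rewrite normrM normrN ler_wpM2r// normrM [X in _ * X]ger0_norm// ler_pdivrMr//.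
  apply: le_trans (ler_normD _ _) _; rewrite mulr_natr mulr2n lerD//; exact: abs_itv.
rewrite /moment_fun.
rewrite (_ : _ - _ = ((y / M) ^+ k - (z / M) ^+ k) * expR (- y ^+ 2 / 2) +
  (z / M) ^+ k * (expR (- y ^+ 2 / 2) - expR (- z ^+ 2 / 2))); last by ring.
apply: le_trans (ler_normD _ _) _; rewrite [leRHS]mulrDl lerD// normrM.
  rewrite -[leRHS]mulr1 ler_pM// ger0_norm ?expR_ge0//.
  by rewrite -[leRHS]expR0 ler_expR.
by rewrite -[leRHS]mul1r ler_pM// normrX exprn_ile1// nM.
Qed.

(* The mesh is 4M/(2m-1) rather than 2M/m, so that each of the [m] half-open
   cells, including the last one, meets [- M, M] in at least half a mesh. *)
Definition mesh (m : nat) : R := 4 * M / (2 * m%:R - 1).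
Definition node (m i : nat) : R := - M + mesh m * i%:R.
Definition cell (m i : nat) : set R :=
  D `&` `[node m i, node m i + mesh m[%classic.

Variable m : nat.
Hypothesis m_gt0 : (0 < m)%N.

Lemma mesh_gt0 : 0 < mesh m.
Proof.
have m1 : 1 <= m%:R :> R by rewrite ler1n.
by rewrite divr_gt0 ?mulr_gt0//; lra.
Qed.

Lemma node_last : node m m = M + mesh m / 2.
Proof.
have m1 : 1 <= m%:R :> R by rewrite ler1n.
by rewrite /node /mesh; field; rewrite gt_eqF//; lra.
Qed.

Lemma half_cell_sub i : (i < m)%N ->
  `[node m i, node m i + mesh m / 2]%classic `<=` cell m i.
Proof.
move=> im x; rewrite /cell/= !in_itv/= => /andP[x1 x2].
have d0 := mesh_gt0.
have i0 : 0 <= mesh m * i%:R by rewrite mulr_ge0// ltW.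
have H : node m i + mesh m <= node m m.
  rewrite /node -addrA lerD2l -[X in _ + X]mulr1 -mulrDr ler_wpM2l ?(ltW d0)//.
  by rewrite natr1 ler_nat.
rewrite node_last in H.
have Mi : - M <= node m i by rewrite /node lerDl.
by split; apply/andP; split; lra.
Qed.

Lemma node_in i : (i < m)%N -> D (node m i).
Proof.
move=> im; have [] // := @half_cell_sub i im (node m i).
by have d0 := mesh_gt0; rewrite /= in_itv/=; apply/andP; split; lra.
Qed.

Lemma measurable_cell i : measurable (cell m i).
Proof. by apply: measurableI; exact: measurable_itv. Qed.

Lemma cellP z : D z -> exists2 i, (i < m)%N & cell m i z.
Proof.
move=> Dz; have d0 := mesh_gt0; have := Dz; rewrite /= in_itv/= => /andP[z1 z2].
have q0 : 0 <= (z + M) / mesh m by rewrite divr_ge0 ?(ltW d0)//; lra.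
have /andP[t1 t2] := truncn_itv q0.
set i := Num.truncn _ in t1 t2.
rewrite ler_pdivlMr// in t1; rewrite ltr_pdivrMr// in t2.
exists i; last first.
  split => //=; rewrite in_itv/= /node; rewrite -natr1 mulrDl mul1r in t2.
  by apply/andP; split; lra.
rewrite ltnNge; apply/negP => mi.
have : mesh m * m%:R <= i%:R * mesh m by rewrite mulrC ler_wpM2r ?(ltW d0)// ler_nat.
by have := node_last; rewrite /node; lra.
Qed.

Lemma trivIset_cell : trivIset setT (cell m).
Proof.
move=> i j _ _ [z [[_ zi] [_ zj]]].
have d0 := mesh_gt0.
wlog ij : i j zi zj / (i <= j)%N.
  by move=> H; have [|/ltnW] := leqP i j => [/H|/H/esym]; apply.
apply/eqP; rewrite eqn_leq ij/= leqNgt; apply/negP => lij.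
move: zi zj; rewrite /= !in_itv/= => /andP[_ z1] /andP[z2 _].
have := le_lt_trans z2 z1; rewrite /node -addrA ltrD2l.
rewrite -[X in _ < _ + X]mulr1 -mulrDr ltr_pM2l// natr1 ltr_nat ltnS.
by rewrite leqNgt lij.
Qed.

Lemma fine_cell_sum F (c : nat -> R) :
  \int[F]_(z in D) (\sum_(i < m) c i * \1_(cell m i) z) =
  \sum_(i < m) c i * fine (F (cell m i)).
Proof.
rewrite (@Rintegral_lincomb _ M F m c (fun i => \1_(cell m i)) 1)//.
- apply: eq_bigr => i _; congr (_ * fine _).
  rewrite integral_indic//; last exact: measurable_cell.
  by congr (F _); rewrite /cell setIAC setIid.
- by move=> k; apply: measurable_indic; exact: measurable_cell.
- by move=> k z _; rewrite indicE normr_nat lern1 leq_b1.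
Qed.

Lemma sum_cell_indic (c : nat -> R) z : D z ->
  exists2 i, (i < m)%N /\ cell m i z & \sum_(i < m) c i * \1_(cell m i) z = c i.
Proof.
move=> Dz; have [i im iz] := cellP Dz; exists i => //.
rewrite (bigD1 (Ordinal im))//= indicE mem_set// mulr1 big1 ?addr0// => j ji.
rewrite indicE memNset ?mulr0// => jz.
move: ji; rewrite -val_eqE/= => /eqP; apply.
by apply: trivIset_cell => //; exists z.
Qed.

Lemma fine_cell_total F : distr_on M F -> \sum_(i < m) fine (F (cell m i)) = 1.
Proof.
move=> FM; have := fine_cell_sum F (fun=> 1).
under [in RHS]eq_bigr do rewrite mul1r.
move=> <-; transitivity (\int[F]_(z in D) (cst 1 z)).
  by apply: eq_Rintegral => z; rewrite inE => /(sum_cell_indic (fun=> 1))[].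
by rewrite Rintegral_cst// distr_on_fine// mulr1.
Qed.

(** Every z is moved to the left end of its cell, at the Lipschitz cost of one mesh. *)
Lemma gauss_moment_cell F (k : nat) : distr_on M F ->
  `|gauss_moment M k F - \sum_(i < m) fine (F (cell m i)) * moment_fun M k (node m i)|
    <= (k%:R / M + M) * mesh m.
Proof.
move=> FM; under eq_bigr do rewrite mulrC.
rewrite -(fine_cell_sum F (fun i => moment_fun M k (node m i))) -RintegralB//; first last.
- apply: (@integrable_bounded _ _ _ _ (\sum_(i < m) `|moment_fun M k (node m i)| * 1)) => //.
    apply: measurable_sum => i; apply: measurable_funM => //.
    by apply: measurable_indic; exact: measurable_cell.
  move=> z _; apply: le_trans (ler_norm_sum _ _ _) _; apply: ler_sum => i _.
  by rewrite normrM ler_wpM2l// indicE normr_nat lern1 leq_b1.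
- apply: (@integrable_bounded _ _ _ _ 1) => //.
    exact: measurable_moment_fun.
  exact: moment_fun_le1.
apply: le_distr_on_Rintegral => //.
  apply: measurable_funB; first exact: measurable_moment_fun.
  apply: measurable_sum => i; apply: measurable_funM => //.
  by apply: measurable_indic; exact: measurable_cell.
move=> z Dz; have [i [im [_ iz]] ->] := sum_cell_indic (fun i => moment_fun M k (node m i)) Dz.
apply: le_trans (moment_fun_lipschitz _ Dz (node_in im)) _.
rewrite ler_wpM2l ?addr_ge0 ?divr_ge0 ?(ltW M_gt0)//.
by move: iz; rewrite /= in_itv/= => /andP[z1 z2]; rewrite ger0_norm; lra.
Qed.

End discretization.
Lemma probability_setIr (R : realType) (d : measure_display) (T : measurableType d)
    (P : probability T R) (A B : set T) : measurable A -> measurable B ->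
  P A = 1%E -> P (A `&` B) = P B.
Proof.
move=> mA mB PA.
have PAc : P (~` A) = 0%E by rewrite probability_setC// PA subee.
rewrite [in RHS](_ : B = (A `&` B) `|` (~` A `&` B)); last first.
  by rewrite -setIUl setUv setTI.
rewrite measureU//; [|exact: measurableI|by apply: measurableI => //; exact: measurableC|].
  rewrite [X in (_ + X)%E](_ : _ = 0%E) ?adde0//.
  apply/eqP; rewrite eq_le measure_ge0 andbT -PAc.
  apply: le_measure; rewrite ?inE//; [|exact: measurableC].
  by apply: measurableI => //; exact: measurableC.
by rewrite setIACA setICr set0I.
Qed.

Section prior_mass.
Context (R : realType) (M : R).
Hypothesis M_gt0 : 0 < M.
Notation D := `[- M, M]%classic.
Variables (alpha : {finite_measure set (measurableTypeR R) -> \bar R}) (a : R -> R).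
Hypothesis a_continuous : {within D, continuous a}.
Hypothesis alpha_density : forall A : set R, measurable A ->
  alpha A = (\int[@lebesgue_measure R]_(x in A `&` D) (a x)%:E)%E.
Variables (amin A : R).
Hypothesis amin_gt0 : 0 < amin.
Hypothesis amin_le : forall x, D x -> amin <= a x.
Hypothesis A_ge1 : 1 <= A.
Hypothesis alpha_le : (alpha setT <= A%:E)%E.

(* Lower bound for the probability that a Gamma variable whose shape is at least the
   [alpha]-mass of a cell falls in a given interval of length [e]. *)
Definition ball_prob (e : R) (m : nat) : R :=
  (e / 2) `^ (A + 1) * expR (- 2) / gamma_fun_bound A (amin * (mesh M m / 2)).

Lemma alpha_cell_ge m i : (i < m)%N ->
  ((amin * (mesh M m / 2))%:E <= alpha (cell M m i))%E.
Proof.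
move=> im; have m0 : (0 < m)%N by exact: leq_ltn_trans im.
have d0 := mesh_gt0 M_gt0 m0.
rewrite alpha_density; last exact: measurable_cell.
have -> : (amin * (mesh M m / 2))%:E =
  (\int[@lebesgue_measure R]_(x in `[node M m i, (node M m i + mesh M m / 2)%R]) cst amin%:E x)%E.
  rewrite integral_cst//= lebesgue_measure_itv/= ifT; last by rewrite lte_fin; lra.
  by rewrite -EFinB -EFinM; congr (_ * _)%:E; lra.
have ma : measurable_fun (D : set R) (EFin \o a).
  by apply/measurable_EFinP; apply: subspace_continuous_measurable_fun.
have mC : measurable (cell M m i `&` D).
  by apply: measurableI => //; exact: measurable_cell.
have sub : `[node M m i, node M m i + mesh M m / 2]%classic `<=` cell M m i `&` D.
  by move=> x /(half_cell_sub M_gt0 m0 im) xc; split => //; case: xc.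
have pos x : D x -> (0 <= (a x)%:E)%E.
  by move=> /amin_le; rewrite lee_fin; apply: le_trans; exact: ltW.
apply: (@le_trans _ _ (\int[@lebesgue_measure R]_(x in `[node M m i, (node M m i + mesh M m / 2)%R]) (a x)%:E)%E).
  apply: ge0_le_integral => //.
  - by move=> x _; rewrite lee_fin ltW.
  - by apply: measurable_funS ma => // x /sub[].
  - by move=> x /sub[_ Dx]; rewrite lee_fin amin_le.
apply: ge0_subset_integral => //.
- by apply: measurable_funS ma => // x [].
- by move=> x [_ /pos].
Qed.

Lemma ball_prob_ge0 e m : (0 < m)%N -> 0 <= ball_prob e m.
Proof.
move=> m0.
have b0 : 0 <= amin * (mesh M m / 2) by rewrite ltW// mulr_gt0// divr_gt0// mesh_gt0.
rewrite !mulr_ge0 ?powR_ge0 ?expR_ge0 ?invr_ge0//.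
by rewrite /gamma_fun_bound addr_ge0 ?invr_ge0// mulr_ge0 ?powR_ge0.
Qed.

Lemma ball_prob_le1 e m : (0 < m)%N -> 0 < e <= 1 -> ball_prob e m <= 1.
Proof.
move=> m0 /andP[e0 e1].
have b0 : 0 < amin * (mesh M m / 2) by rewrite mulr_gt0// divr_gt0// mesh_gt0.
have B1 : 1 <= gamma_fun_bound A (amin * (mesh M m / 2)).
  rewrite /gamma_fun_bound; apply: (@le_trans _ _ (2 * 1)); first by lra.
  rewrite ler_wpDl ?invr_ge0 ?(ltW b0)// ler_wpM2l//.
  apply: (@le_trans _ _ (1 `^ A)); first by rewrite powR1.
  by apply: ge0_ler_powR; rewrite ?nnegrE; move: A_ge1; lra.
rewrite /ball_prob ler_pdivrMr ?mul1r ?(lt_le_trans _ B1)//.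
have E1 : expR (- 2) <= 1 :> R by rewrite -[leRHS]expR0 ler_expR lerNl oppr0.
have p1 : (e / 2) `^ (A + 1) <= 1.
  apply: (@le_trans _ _ (1 `^ (A + 1))); last by rewrite powR1.
  by apply: ge0_ler_powR; rewrite ?nnegrE; move: A_ge1; lra.
by apply: le_trans B1; rewrite mulr_ile1 ?powR_ge0 ?expR_ge0.
Qed.

Lemma gamma_law_cell_ge (m : nat) (b w e : R) : (0 < m)%N ->
  amin * (mesh M m / 2) <= b -> b <= A -> 0 <= w <= 1 -> 0 < e <= 1 ->
  gamma_law b setT = 1%E ->
  ((ball_prob e m)%:E <= gamma_law b `[w, (w + e)%R])%E.
Proof.
move=> m0 b0 bA w01 e01 mass.
have c0 : 0 < amin * (mesh M m / 2) by rewrite mulr_gt0// divr_gt0// mesh_gt0.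
have b0' : 0 < b by apply: lt_le_trans b0.
apply: le_trans (gamma_law_itv_ge A_ge1 b0' bA w01 e01 mass).
rewrite lee_fin ler_wpM2l ?mulr_ge0 ?powR_ge0 ?expR_ge0//.
have p0 : 0 <= 2 * (2 * A) `^ A by rewrite mulr_ge0 ?powR_ge0.
rewrite lef_pV2 ?posrE /gamma_fun_bound ?lerD2r ?lef_pV2 ?posrE//.
- by rewrite ltr_wpDr// invr_gt0.
- by rewrite ltr_wpDr// invr_gt0.
Qed.

(** By Caratheodory the masses of [Fs] at the nodes are replaced by weights on at most K + 1 nodes,
    with the same K moments and the same total mass. Together with the remainder of the interval
    this leaves at most K + 2 cells, however fine the mesh. The first error term comes from
    discretizing F and [Fs], the second from the l1 distance between cell masses and weights. *)
Lemma dirichlet_process_moment_ball (Pi : probability (distr R) R) (Fs : distr R)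
    (K m : nat) (e : R) :
  dirichlet_process M alpha Pi -> distr_on M Fs -> (0 < m)%N ->
  0 < e -> K.+2%:R * e <= 1 ->
  exists V : set (distr R), [/\ measurable V, V `<=` distr_on M,
    ((ball_prob e m ^+ K.+2)%:E <= Pi V)%E &
    forall F, V F -> forall k, (k < K)%N ->
      `|gauss_moment M k F - gauss_moment M k Fs|
        <= 2 * (K%:R / M + M) * mesh M m + 2 * K.+2%:R ^+ 2 * e].
Proof.
move=> [PiM DP] FsM m0 e0 Ke.
have d0 := mesh_gt0 M_gt0 m0.
(* The last coordinate is 1, so that the total mass is preserved along with the moments. *)
pose v (i : 'I_m) : 'rV[R]_K.+1 :=
  \row_(j < K.+1) (if (j < K)%N then moment_fun M j (node M m i) else 1).
have [w [w0 wv wS]] := conic_caratheodory v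
  (fun i : 'I_m => fine_ge0 (measure_ge0 Fs (cell M m i))).
have wk (k : nat) : (k < K)%N -> \sum_(i < m) w i * moment_fun M k (node M m i) =
    \sum_(i < m) fine (Fs (cell M m i)) * moment_fun M k (node M m i).
  move=> kK; have kK1 : (k < K.+1)%N by rewrite ltnS ltnW.
  move/rowP/(_ (Ordinal kK1)): wv; rewrite !summxE.
  by under eq_bigr do rewrite !mxE/= kK; under [RHS]eq_bigr do rewrite !mxE/= kK.
have w1 : \sum_(i < m) w i = 1.
  rewrite -(fine_cell_total M_gt0 m0 FsM).
  move/rowP/(_ ord_max): wv; rewrite !summxE.
  under eq_bigr do rewrite !mxE/= ltnn mulr1.
  by under [RHS]eq_bigr do rewrite !mxE/= ltnn mulr1.
set J := [set i | w i != 0]%SET in wS.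
(* The Dirichlet process is evaluated on the cells charged by [w] and the rest of
   the interval, which has index [ord0]. *)
pose rest := D `&` ~` (\bigcup_(i in [set i : 'I_m | i \in J]) cell M m i).
pose cells (i : 'I_#|J|.+1) : set R :=
  if unlift ord0 i is Some j then cell M m (enum_val j) else rest.
pose wt (i : 'I_#|J|.+1) : R :=
  if unlift ord0 i is Some j then w (enum_val j) else 0.
have wt0 i : 0 <= wt i by rewrite /wt; case: unlift.
have sumJ (f : 'I_m -> R) : (forall i, w i = 0 -> f i = 0) ->
    \sum_(j < #|J|) f (enum_val j) = \sum_(i < m) f i.
  move=> f0; rewrite -(@big_enum_val _ _ _ _ (mem J) f)/= [RHS](bigID (mem J))/= [X in _ = _ + X]big1 ?addr0//.
  by move=> i; rewrite inE negbK => /eqP /f0.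
have wt1 : \sum_i wt i = 1.
  rewrite big_ord_recl/= {1}/wt unlift_none add0r -[RHS]w1 -(sumJ w)//.
  by apply: eq_bigr => j _; rewrite /wt liftK.
pose N := #|J|.
have mcells i : measurable (cells i).
  rewrite /cells; case: unlift => [j|]; first exact: measurable_cell.
  apply: measurableI => //; apply: measurableC.
  by apply: fin_bigcup_measurable => // i' _; exact: measurable_cell.
have cellD i : cell M m i `<=` D by move=> x [].
have trivcells : trivIset [set: 'I_N.+1] cells.
  move=> i j _ _; rewrite /cells.
  case: unliftP => [i' ->|->]; case: unliftP => [j' ->|->] //=.
  - by move=> H; have /val_inj/enum_val_inj -> := @trivIset_cell _ _ M_gt0 _ m0 _ _ I I H.
  - by move=> [x [xi [_]]] []; exists (enum_val i') => //=; exact: enum_valP.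
  - by move=> [x [[_ H] xi]]; exfalso; apply: H; exists (enum_val j') => //=; exact: enum_valP.
have covcells : \bigcup_i cells i = D.
  apply/seteqP; split => [x [i _]|x Dx].
    by rewrite /cells; case: unlift => [j|]; [exact: cellD|case].
  have [[i iJ xi]|H] := pselect (exists2 i : 'I_m, i \in J & cell M m i x).
    by exists (lift ord0 (enum_rank_in iJ i)) => //; rewrite /cells liftK enum_rankK_in.
  exists ord0 => //; rewrite /cells unlift_none; split => //.
have law := DP _ cells mcells trivcells covcells.
have alphaA B : measurable B -> (alpha B <= A%:E)%E.
  by move=> mB; apply: le_trans alpha_le; apply: le_measure; rewrite ?inE.
have fineA B : measurable B -> fine (alpha B) <= A.
  by move=> mB; rewrite -lee_fin fineK ?fin_num_measure// alphaA.
have NK : (N.+1 <= K.+2)%N by [].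
have NKR : N.+1%:R <= K.+2%:R :> R by rewrite ler_nat.
have e1 : 0 < e <= 1.
  rewrite e0/=; apply: le_trans Ke; rewrite ler_peMl ?(ltW e0)// ler1n//.
have g1 := ball_prob_le1 m0 e1.
have g0 := ball_prob_ge0 e m0.
have wt_le1 i : wt i <= 1.
  by rewrite -wt1 (bigD1 i)//= lerDl; apply: sumr_ge0.
have wt01 i : 0 <= wt i <= 1 by rewrite wt0 wt_le1.
have cell_lower i B : (i < m)%N -> measurable B -> cell M m i `<=` B ->
    amin * (mesh M m / 2) <= fine (alpha B).
  move=> im mB sub; rewrite -lee_fin fineK ?fin_num_measure//.
  apply: le_trans (alpha_cell_ge im) _; apply: le_measure; rewrite ?inE//.
  exact: measurable_cell.
have gle i : gamma_law (fine (alpha (cells i))) setT = 1%E ->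
    ((ball_prob e m)%:E <= gamma_law (fine (alpha (cells i))) `[wt i, (wt i + e)%R])%E.
  have [cl|cl] := leP (amin * (mesh M m / 2)) (fine (alpha (cells i))).
    by apply: gamma_law_cell_ge => //; apply: fineA; exact: mcells.
  move=> _; move: cl; rewrite /wt; case: (unliftP ord0 i) => [j ij|i0] cl.
    exfalso; move: cl; rewrite ltNge => /negP; apply.
    by apply: (@cell_lower (enum_val j)) => //; rewrite /cells ij liftK.
  (* The remainder has weight 0. If its mass is below the bound it contains no cell, so every cell
     is charged and the remainder is empty. Its parameter is then 0, and the point mass at 0 gives
     [0, e] probability 1. *)
  suff rest0 : fine (alpha (cells i)) = 0.
    rewrite rest0 /gamma_law eqxx diracE mem_set ?lee_fin//=.
    by rewrite in_itv/= lexx add0r ltW.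
  have [JT|[i' i'J]] : J = [set: 'I_m]%SET \/ exists i', i' \notin J.
  - have [/forallP H|] := boolP [forall i', i' \in J]; last first.
      by rewrite negb_forall => /existsP[i' ?]; right; exists i'.
    by left; apply/setP => i'; rewrite finset.in_setT; exact: H.
  - rewrite (_ : cells i = set0) ?measure0// /cells i0 unlift_none.
    apply/seteqP; split => // x [Dx]; apply.
    have [i' im xi] := cellP M_gt0 m0 Dx.
    by exists (Ordinal im) => //=; rewrite JT finset.in_setT.
  exfalso; move: cl; rewrite ltNge => /negP; apply.
  apply: (@cell_lower i') => // x xi; rewrite /cells i0 unlift_none; split.
    exact: cellD xi.
  move=> [j jJ xj]; move: i'J; suff -> : i' = j by rewrite jJ.
  by apply: val_inj; apply: (trivIset_cell M_gt0 m0) => //; exists x.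
have Ne : N.+1%:R * e <= 1 by apply: le_trans Ke; rewrite ler_wpM2r// ltW.
have ball := dirichlet_small_ball law wt0 wt1 e0 Ne g0 gle.
set T := [set t | _] in ball.
pose V0 : set (distr R) := [set F | forall i, `|fine (F (cells i)) - wt i| <= N.+1%:R * e].
have mV0 : measurable V0.
  rewrite (_ : V0 = \bigcap_(i in [set: 'I_N.+1])
      [set F : distr R | `|fine (F (cells i)) - wt i| <= N.+1%:R * e]); last first.
    by apply/seteqP; split => [F H i _|F H i]; apply: H.
  apply: fin_bigcap_measurable => // i _.
  have mt : measurable_fun [set: distr R] (fun F : distr R => `|fine (F (cells i)) - wt i|).
    apply: measurableT_comp => //; apply: measurable_funB => //.
    by apply: measurableT_comp => //; exact: measurable_distr_eval.
  rewrite (_ : [set F | _] = (fun F : distr R => `|fine (F (cells i)) - wt i|) @^-1` `]-oo, (N.+1%:R * e)]).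
    by rewrite -[X in measurable X]setTI; exact: mt.
  by apply/seteqP; split => t /=; rewrite in_itv.
have V0E : pushforward Pi (fun F : distr R => [tuple fine (F (cells i)) | i < N.+1]) T = Pi V0.
  rewrite /pushforward; congr (Pi _); apply/seteqP; split => F H i.
    by have := H i; rewrite tnth_mktuple.
  by rewrite tnth_mktuple; exact: H.
exists (distr_on M `&` V0); split.
- by apply: measurableI => //; exact: measurable_distr_on.
- by move=> F [].
- rewrite probability_setIr//; last exact: measurable_distr_on.
  rewrite -V0E; apply: le_trans ball; rewrite lee_fin.
  (* The actual number of cells may be smaller than K + 2; the larger exponent is allowed since
     [ball_prob] is at most 1. *)
  by apply: ler_wiXn2l => //; rewrite g0.
move=> F [FM FV] k kK.
have HJ (j : 'I_#|J|) : `|fine (F (cell M m (enum_val j))) - w (enum_val j)| <= K.+2%:R * e.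
  have := FV (lift ord0 j); rewrite /cells /wt liftK => /le_trans; apply.
  by rewrite ler_wpM2r// ltW.
pose q (i : 'I_m) := fine (F (cell M m i)).
have q0 i : 0 <= q i by rewrite /q fine_ge0.
have qJ : \sum_(j < #|J|) `|q (enum_val j) - w (enum_val j)| <= K.+2%:R * (K.+2%:R * e).
  apply: (@le_trans _ _ (\sum_(j < #|J|) (K.+2%:R * e))); first by apply: ler_sum => j _; exact: HJ.
  rewrite sumr_const card_ord -[leLHS]mulr_natl ler_wpM2r ?mulr_ge0 ?(ltW e0)//.
  by rewrite ler_nat (leq_trans _ NK).
have qw : \sum_(i < m) `|q i - w i| <= 2 * K.+2%:R ^+ 2 * e.
  have qT : \sum_(i < m) q i = 1 by exact: fine_cell_total.
  rewrite (bigID (mem J))/= (@big_enum_val _ _ _ _ (mem J) (fun i => `|q i - w i|))/=.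
  rewrite (_ : 2 * _ ^+ 2 * e = K.+2%:R * (K.+2%:R * e) + K.+2%:R * (K.+2%:R * e)); last by ring.
  apply: lerD => //.
  have -> : \sum_(i < m | i \notin J) `|q i - w i| = \sum_(i < m | i \notin J) q i.
    apply: eq_bigr => i; rewrite inE negbK => /eqP ->.
    by rewrite subr0 ger0_norm.
  (* Both q and w have total mass 1 and w lives on [J]: the mass of q off [J] is what it lacks on
     [J]. No cell off [J] has to be controlled individually. *)
  have -> : \sum_(i < m | i \notin J) q i = \sum_(j < #|J|) (w (enum_val j) - q (enum_val j)).
    rewrite sumrB (sumJ w)// w1 -qT [X in X - _](bigID (mem J))/=.
    by rewrite (@big_enum_val _ _ _ _ (mem J) q)/= addrAC subrr add0r.
  apply: le_trans qJ; apply: ler_sum => j _.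
  by rewrite distrC ler_norm.
have HF := gauss_moment_cell M_gt0 m0 k FM.
have HFs := gauss_moment_cell M_gt0 m0 k FsM.
rewrite -(wk _ kK) in HFs.
have Hqw : `|\sum_(i < m) q i * moment_fun M k (node M m i) -
    \sum_(i < m) w i * moment_fun M k (node M m i)| <= 2 * K.+2%:R ^+ 2 * e.
  rewrite -sumrB; under eq_bigr do rewrite -mulrBl.
  apply: le_trans (ler_norm_sum _ _ _) _; apply: le_trans qw.
  apply: ler_sum => i _; rewrite normrM -[leRHS]mulr1 ler_wpM2l//.
  by apply: moment_fun_le1 => //; exact: node_in.
have kKR : (k%:R / M + M) * mesh M m <= (K%:R / M + M) * mesh M m.
  rewrite ler_wpM2r ?(ltW d0)// lerD2r ler_wpM2r ?invr_ge0 ?(ltW M_gt0)//.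
  by rewrite ler_nat ltnW.
set mF := gauss_moment M k F in HF *; set mFs := gauss_moment M k Fs in HFs *.
set sF := \sum_(i < m) _ in HF Hqw; set sw := \sum_(i < m) _ in HFs Hqw.
rewrite (_ : mF - mFs = (mF - sF) - (mFs - sw) + (sF - sw)); last by ring.
apply: le_trans (ler_normD _ _) _; apply: lerD => //.
apply: le_trans (ler_normB _ _) _; rewrite -mulrA mulr_natl mulr2n; apply: lerD.
  exact: le_trans kKR.
exact: le_trans kKR.
Qed.

End prior_mass.

(** * The Kullback-Leibler projection *)

Section mixture_of_distributions.
Context (R : realType).

Lemma exists_convex_distr (F G : distr R) (t : R) : 0 <= t <= 1 ->
  exists H : distr R, forall A, measurable A ->
    H A = ((1 - t)%:E * F A + t%:E * G A)%E.
Proof.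
move=> /andP[t0 t1].
have t1' : 0 <= 1 - t by rewrite subr_ge0.
pose nu := measure_add (mscale (NngNum t1') F) (mscale (NngNum t0) G).
have nuE A : nu A = ((1 - t)%:E * F A + t%:E * G A)%E by rewrite /nu/= measure_addE.
have nuT : nu setT = 1%E.
  by rewrite nuE !probability_setT !mule1 -EFinD subrK.
(* [nu] already has mass 1: normalizing only packs it as a probability, and F is the default value
   for degenerate masses. *)
pose H : probability (measurableTypeR R) R := mnormalize nu F.
exists H => A mA; rewrite -nuE.
rewrite [LHS](_ : _ = mnormalize nu F A)// /mnormalize.
rewrite [X in (X == 0%E) || _]nuT [X in _ || (X == +oo%E)]nuT onee_eq0/=.
by rewrite [X in fine X]nuT invr1 mule1.
Qed.

Lemma mix_pdf_convex (F G H : distr R) (t x : R) : 0 <= t <= 1 ->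
  (forall A, measurable A -> H A = ((1 - t)%:E * F A + t%:E * G A)%E) ->
  mix_pdf H x = (1 - t) * mix_pdf F x + t * mix_pdf G x.
Proof.
move=> /andP[t0 t1] HE.
have t1' : 0 <= 1 - t by rewrite subr_ge0.
have mn : measurable_fun [set: R] (fun z : R => (normal_pdf 0 1 (x - z))%:E).
  apply/measurable_EFinP; apply: measurableT_comp; first exact: measurable_normal_pdf.
  exact: measurable_funB.
have n0 (z : R) : (0 <= (normal_pdf 0 1 (x - z))%:E)%E by rewrite lee_fin normal_pdf_ge0.
have fin (K : distr R) : (\int[K]_z (normal_pdf 0 1 (x - z))%:E)%E \is a fin_num.
  rewrite ge0_fin_numE; last exact: integral_ge0.
  apply: (@le_lt_trans _ _ (\int[K]_z cst (normal_peak 1)%:E z)%E).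
    apply: ge0_le_integral => // z _.
    by rewrite lee_fin normal_pdf_ub ?oner_neq0.
  by rewrite integral_cst//= probability_setT mule1 ltry.
pose nu := measure_add (mscale (NngNum t1') F) (mscale (NngNum t0) G).
have nuE A : nu A = ((1 - t)%:E * F A + t%:E * G A)%E by rewrite /nu/= measure_addE.
rewrite /mix_pdf /Rintegral (eq_measure_integral nu); last first.
  by move=> A mA _; exact: etrans (HE A mA) (esym (nuE A)).
rewrite ge0_integral_measure_add// !ge0_integral_mscale//.
by rewrite fineD ?fin_numM ?fineM ?fin//.
Qed.

End mixture_of_distributions.

Section gaussian_tails.
Context (R : realType).
Notation mu := (@lebesgue_measure R).

Lemma integral_expR_quadratic (c : R) :
  (\int[mu]_x (expR (- x ^+ 2 / 2 + c * x))%:E < +oo)%E.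
Proof.
have E (x : R) : expR (- x ^+ 2 / 2 + c * x) =
    (expR (c ^+ 2 / 2) / normal_peak 1) * normal_pdf c 1 x.
  rewrite normal_pdfE ?oner_neq0// mulrA divfK ?gt_eqF ?normal_peak_gt0 ?oner_neq0//.
  rewrite /normal_fun -expRD; congr expR; rewrite expr1n; by field.
under eq_integral do rewrite E EFinM.
rewrite ge0_integralZl//.
- by rewrite integral_normal_pdf mule1 ltry.
- by apply/measurable_EFinP; exact: measurable_normal_pdf.
- by move=> x _; rewrite lee_fin normal_pdf_ge0.
- by rewrite lee_fin divr_ge0 ?expR_ge0 ?normal_peak_ge0.
Qed.

Lemma measurable_expR_quadratic_abs (c : R) :
  measurable_fun [set: R] (fun x : R => expR (- x ^+ 2 / 2 + c * `|x|)).
Proof.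
apply: measurableT_comp => //; apply: measurable_funD; last exact: measurable_funM.
by apply: measurable_funM => //; apply: measurableT_comp => //; exact: measurable_funX.
Qed.

Lemma integral_expR_quadratic_abs (c : R) :
  (\int[mu]_x (expR (- x ^+ 2 / 2 + c * `|x|))%:E < +oo)%E.
Proof.
have m (b : R) : measurable_fun [set: R] (fun x : R => (expR (- x ^+ 2 / 2 + b * x))%:E).
  apply/measurable_EFinP; apply: measurableT_comp => //; apply: measurable_funD; last exact: measurable_funM.
  by apply: measurable_funM => //; apply: measurableT_comp => //; exact: measurable_funX.
(* One of the two signs of c reproduces c |x|, and the other summand is positive. *)
apply: (@le_lt_trans _ _ (\int[mu]_x ((expR (- x ^+ 2 / 2 + c * x))%:E
    + (expR (- x ^+ 2 / 2 + - c * x))%:E))%E).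
  apply: ge0_le_integral => //.
  - by apply/measurable_EFinP; exact: measurable_expR_quadratic_abs.
  - by apply: emeasurable_funD; apply: m.
  - move=> x _; rewrite -EFinD lee_fin.
    have [x0|x0] := leP 0 x; first by rewrite ger0_norm// lerDl expR_ge0.
    by rewrite ltr0_norm// mulrN -mulNr lerDr expR_ge0.
rewrite ge0_integralD//.
- by rewrite lte_add_pinfty ?integral_expR_quadratic.
- exact: m.
- exact: m.
Qed.

End gaussian_tails.

(** * Integrability under P0 and the inequalities satisfied by the minimizer *)

Section kl_projection.
Context (R : realType) (M : R).
Hypothesis M_gt0 : 0 < M.
Notation mu := (@lebesgue_measure R).
Variables (P0 : distr R) (p0 : R -> R).
Hypothesis P0_density : has_density P0 p0.
Variable Fs : distr R.
Hypothesis Fs_min : is_kl_minimizer M P0 p0 Fs.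
Hypothesis p0_bounded : (fun x => p0 x / mix_pdf Fs x) \in Lfun mu +oo%E.

Let mp0 : measurable_fun [set: R] p0. Proof. by case: P0_density. Qed.
Let p0_ge0 x : 0 <= p0 x. Proof. by case: P0_density. Qed.
Let FsM : distr_on M Fs. Proof. by case: Fs_min. Qed.
Let ps_gt0 x : 0 < mix_pdf Fs x. Proof. exact: (mix_pdf_gt0 M_gt0). Qed.

Lemma density_le : exists2 C : R, 0 <= C & {ae mu, forall x, p0 x <= C * mix_pdf Fs x}.
Proof.
(* The norm in L_oo is defined by cases on whether the space has positive measure. *)
have muT : (0 < mu [set: R])%E by rewrite -set_itvNyy lebesgue_measure_itv/= ltry.
move: p0_bounded; rewrite inE => /andP[_]; rewrite inE /= /finite_norm unlock muT => H.
have [C HC] : exists C, {ae mu, forall x, `|p0 x / mix_pdf Fs x| <= C}.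
  exact: ess_supr_bounded.
exists `|C| => //; case: HC => N [mN N0 HN]; exists N; split => //.
apply: subset_trans HN; apply: subsetC => x /=.
rewrite ger0_norm ?divr_ge0// ?(ltW (ps_gt0 x))// ler_pdivrMr// => /le_trans; apply.
by rewrite ler_wpM2r ?ler_norm// ltW.
Qed.

Lemma integral_P0 (f : R -> \bar R) : measurable_fun [set: R] f ->
  (forall x, (0 <= f x)%E) ->
  (\int[P0]_x f x = \int[mu]_x (f x * (p0 x)%:E))%E.
Proof.
move=> mf f0; apply: ge0_integral_density => //.
by case: P0_density.
Qed.

(** The bound p0 <= C p_F* transfers the Gaussian tails of the mixture to P0; all integrability
    below is reduced to this. *)
Lemma exponential_moment (c : R) :
  (\int[P0]_x (expR (c * `|x|))%:E < +oo)%E.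
Proof.
have [C C0 HC] := density_le.
have me : measurable_fun [set: R] (fun x : R => expR (c * `|x|)).
  by apply: measurableT_comp => //; exact: measurable_funM.
rewrite integral_P0//; last exact/measurable_EFinP.
apply: (@le_lt_trans _ _ (\int[mu]_x ((C * normal_peak 1)%:E
   * (expR (- x ^+ 2 / 2 + (c + M) * `|x|))%:E))%E).
  apply: ae_ge0_le_integral => //.
  - by move=> x _; rewrite -EFinM lee_fin mulr_ge0 ?expR_ge0.
  - by apply: emeasurable_funM; apply/measurable_EFinP.
  - by move=> x _; rewrite -EFinM lee_fin !mulr_ge0 ?expR_ge0 ?normal_peak_ge0.
  - apply: measurable_funeM; apply/measurable_EFinP; exact: measurable_expR_quadratic_abs.
  - case: HC => N [mN N0 HN]; exists N; split => //.
    apply: subset_trans HN; apply: subsetC => x /= Hx _; rewrite -!EFinM lee_fin.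
    apply: (@le_trans _ _ (expR (c * `|x|) * (C * (normal_peak 1 * expR (- x ^+ 2 / 2 + M * `|x|))))).
      rewrite ler_wpM2l ?expR_ge0// (le_trans Hx)// ler_wpM2l//.
      exact: (mix_pdf_le M_gt0 _ FsM).
    have -> : expR (- x ^+ 2 / 2 + (c + M) * `|x|) =
        expR (c * `|x|) * expR (- x ^+ 2 / 2 + M * `|x|).
      by rewrite -expRD; congr expR; ring.
    by rewrite le_eqVlt; apply/orP; left; apply/eqP; ring.
rewrite ge0_integralZl//.
- by rewrite lte_mul_pinfty ?lee_fin ?mulr_ge0 ?normal_peak_ge0 ?integral_expR_quadratic_abs.
- by apply/measurable_EFinP; exact: measurable_expR_quadratic_abs.
- by rewrite lee_fin mulr_ge0 ?normal_peak_ge0.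
Qed.

Lemma integrable_exp_bounded (f : R -> R) (c b : R) : measurable_fun [set: R] f ->
  (forall x, `|f x| <= b * expR (c * `|x|)) -> P0.-integrable setT (EFin \o f).
Proof.
move=> mf fb; apply/integrableP; split; first exact/measurable_EFinP.
have b0 : 0 <= b.
  by have := le_trans (normr_ge0 _) (fb 0); rewrite normr0 mulr0 expR0 mulr1.
have me : measurable_fun [set: R] (fun x : R => (expR (c * `|x|))%:E).
  by apply/measurable_EFinP; apply: measurableT_comp => //; exact: measurable_funM.
apply: (@le_lt_trans _ _ (\int[P0]_x (b%:E * (expR (c * `|x|))%:E))%E).
  apply: ge0_le_integral => //.
  - by apply: measurableT_comp => //; exact/measurable_EFinP.
  - exact: measurable_funeM.
  - by move=> x _; rewrite -EFinM/= lee_fin.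
rewrite ge0_integralZl//.
- by rewrite lte_mul_pinfty ?lee_fin ?exponential_moment.
Qed.

(** The rate 2 in Markov's inequality is chosen for T = ln n: after a union bound over n
    observations 1/n remains. *)
Lemma tail_bound : exists2 C : R, 0 <= C &
  forall T : R, (P0 [set x | (T < `|x|)%R] <= (C * expR (- 2 * T))%:E)%E.
Proof.
pose C := fine (\int[P0]_x (expR (2 * `|x|))%:E)%E.
have Cfin : (\int[P0]_x (expR (2 * `|x|))%:E)%E \is a fin_num.
  rewrite ge0_fin_numE ?exponential_moment//.
  by apply: integral_ge0 => x _; rewrite lee_fin expR_ge0.
have me : measurable_fun [set: R] (fun x : R => (expR (2 * `|x|))%:E).
  by apply/measurable_EFinP; apply: measurableT_comp => //; exact: measurable_funM.
exists C; first by apply: fine_ge0; apply: integral_ge0 => x _; rewrite lee_fin expR_ge0.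
move=> T.
have mT : measurable [set x : R | T < `|x|].
  rewrite (_ : [set x | _] = (fun x : R => `|x|) @^-1` `]T, +oo[%classic); last first.
    by apply/seteqP; split => x /=; rewrite in_itv/= andbT.
  by rewrite -[X in measurable X]setTI; apply: normr_measurable.
rewrite EFinM fineK// muleC.
have -> : P0 [set x | T < `|x|] = (\int[P0]_x (\1_[set x | T < `|x|] x)%:E)%E.
  by rewrite integral_indic// setIT.
rewrite -ge0_integralZl//.
apply: ge0_le_integral => //.
- by apply/measurable_EFinP; exact: measurable_indic.
- exact: measurable_funeM.
- move=> x _; rewrite -EFinM lee_fin -expRD indicE.
  have [|_] := boolP (x \in _); last by rewrite expR_ge0.
  by rewrite inE/= => Tx; rewrite -[leLHS]expR0 ler_expR; lra.
Qed.

Definition mix_ratio (F : distr R) (x : R) : R := mix_pdf F x / mix_pdf Fs x.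

Lemma measurable_ratio F : measurable_fun [set: R] (mix_ratio F).
Proof.
apply: measurable_funM; first exact: measurable_mix_pdf_section.
by apply: measurable_funV; exact: measurable_mix_pdf_section.
Qed.

Lemma mix_ratio_gt0 F x : distr_on M F -> 0 < mix_ratio F x.
Proof. by move=> FM; rewrite divr_gt0// (mix_pdf_gt0 M_gt0). Qed.

Lemma mix_ratio_le F x : distr_on M F ->
  mix_ratio F x <= expR (M ^+ 2 / 2) * expR (2 * M * `|x|).
Proof.
move=> FM; rewrite ler_pdivrMr//.
apply: le_trans (mix_pdf_le M_gt0 x FM) _.
apply: (@le_trans _ _ (expR (M ^+ 2 / 2) * expR (2 * M * `|x|) *
  (normal_peak 1 * expR (- x ^+ 2 / 2 - M * `|x| - M ^+ 2 / 2)))); last first.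
  by rewrite ler_wpM2l ?mulr_ge0 ?expR_ge0// (mix_pdf_ge M_gt0 _ FsM).
rewrite mulrCA ler_wpM2l ?normal_peak_ge0// -!expRD ler_expR.
by rewrite le_eqVlt; apply/orP; left; apply/eqP; ring.
Qed.

Lemma ln_bounds (y : R) : 0 < y -> `|ln y| <= y + y^-1.
Proof.
move=> y0; have H1 := ltW (ln_sublinear y0).
have yV0 : 0 < y^-1 by rewrite invr_gt0.
have := ltW (ln_sublinear yV0); rewrite lnV ?posrE// => H2.
rewrite ler_norml; apply/andP; split; lra.
Qed.

Lemma integral_density1 : (\int[mu]_x (p0 x)%:E = 1)%E.
Proof.
by case: P0_density => _ _ /(_ setT measurableT) <-; rewrite probability_setT.
Qed.

(** With y = p_F* / p0, |ln y| <= y + 1/y gives |ln y| p0 <= p_F* + p0^2 / p_F* <= p_F* + C p0.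
    Finiteness of the minimal loss is what permits subtracting it when losses are compared. *)
Lemma kl_integrable :
  P0.-integrable setT (EFin \o (fun x => - ln (mix_pdf Fs x / p0 x))).
Proof.
have [C C0 HC] := density_le.
have mps : measurable_fun [set: R] (mix_pdf Fs) by exact: measurable_mix_pdf_section.
have mg : measurable_fun [set: R] (fun x => - ln (mix_pdf Fs x / p0 x)).
  apply: measurableT_comp => //; apply: (measurableT_comp (@measurable_ln R)).
  by apply: measurable_funM => //; exact: measurable_funV.
apply/integrableP; split; first exact/measurable_EFinP.
rewrite integral_P0//; last first.
  by apply: measurableT_comp => //; exact/measurable_EFinP.
apply: (@le_lt_trans _ _ (\int[mu]_x (C%:E * (p0 x)%:E
    + (normal_peak 1)%:E * (expR (- x ^+ 2 / 2 + M * `|x|))%:E))%E).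
  apply: ae_ge0_le_integral => //.
  - by move=> x _; rewrite mule_ge0 ?lee_fin.
  - apply: emeasurable_funM; last exact/measurable_EFinP.
    by apply: measurableT_comp => //; exact/measurable_EFinP.
  - move=> x _; rewrite adde_ge0// mule_ge0 ?lee_fin ?normal_peak_ge0//.
  - apply: emeasurable_funD; apply: measurable_funeM; apply/measurable_EFinP => //.
    exact: measurable_expR_quadratic_abs.
  - case: HC => N [mN N0 HN]; exists N; split => //.
    apply: subset_trans HN; apply: subsetC => x /= Hx _.
    rewrite -!EFinM -EFinD lee_fin normrN.
    have ps_le := mix_pdf_le M_gt0 x FsM.
    have [p00|p00] := eqVneq (p0 x) 0.
      by rewrite p00 !mulr0 add0r (le_trans _ ps_le)// ltW.
    have p0gt : 0 < p0 x by rewrite lt_neqAle eq_sym p00 p0_ge0.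
    have y0 : 0 < mix_pdf Fs x / p0 x by rewrite divr_gt0.
    apply: (@le_trans _ _ ((mix_pdf Fs x / p0 x + p0 x / mix_pdf Fs x) * p0 x)).
      by rewrite ler_wpM2r// -[p0 x / _]invf_div ln_bounds.
    rewrite mulrDl divfK// addrC lerD// ler_wpM2r// ler_pdivrMr//.
rewrite ge0_integralD//.
- rewrite !ge0_integralZl//.
  + rewrite integral_density1 mule1 lte_add_pinfty ?ltry// lte_mul_pinfty ?lee_fin ?normal_peak_ge0//.
    exact: integral_expR_quadratic_abs.
  + by apply/measurable_EFinP; exact: measurable_expR_quadratic_abs.
  + by rewrite lee_fin normal_peak_ge0.
  + exact/measurable_EFinP.
  + by move=> x _; rewrite lee_fin.
- by move=> x _; rewrite mule_ge0 ?lee_fin.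
- by apply: measurable_funeM; exact/measurable_EFinP.
- by move=> x _; rewrite mule_ge0 ?lee_fin ?normal_peak_ge0.
- by apply: measurable_funeM; apply/measurable_EFinP; exact: measurable_expR_quadratic_abs.
Qed.

Lemma integrable_ratio F : distr_on M F -> P0.-integrable setT (EFin \o mix_ratio F).
Proof.
move=> FM; apply: (integrable_exp_bounded (c := 2 * M) (b := expR (M ^+ 2 / 2))).
  exact: measurable_ratio.
by move=> x; rewrite gtr0_norm ?mix_ratio_gt0// mix_ratio_le.
Qed.

Lemma integrable_le_ratio F (f : R -> R) (a b : R) : distr_on M F ->
  measurable_fun [set: R] f -> 0 <= a -> 0 <= b ->
  (forall x, `|f x| <= a + b * mix_ratio F x ^+ 2) -> P0.-integrable setT (EFin \o f).
Proof.
move=> FM mf a0 b0 fab.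
apply: (integrable_exp_bounded (c := 4 * M) (b := a + b * expR (M ^+ 2 / 2) ^+ 2)) => //.
move=> x; apply: le_trans (fab x) _; rewrite mulrDl lerD//.
  rewrite ler_peMr// -[leLHS]expR0 ler_expR !mulr_ge0// ltW//.
rewrite -mulrA ler_wpM2l//.
apply: (@le_trans _ _ ((expR (M ^+ 2 / 2) * expR (2 * M * `|x|)) ^+ 2)).
  have r0 := mix_ratio_gt0 x FM.
  by rewrite lerXn2r ?mix_ratio_le// nnegrE ?(ltW r0)// mulr_ge0 ?expR_ge0.
rewrite exprMn ler_wpM2l ?sqr_ge0// -expRM_natl ler_expR.
by rewrite le_eqVlt; apply/orP; left; apply/eqP; ring.
Qed.

(** Where p0 vanishes the ratio in [kl_loss] is 0 by convention, and the logarithm of a product does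
    not split. *)
Lemma ae_density_gt0 : {ae P0, forall x, 0 < p0 x}.
Proof.
have mz : measurable [set x | p0 x = 0].
  rewrite (_ : [set x | _] = p0 @^-1` [set 0])//.
  by rewrite -[X in measurable X]setTI; exact: mp0.
exists [set x | p0 x = 0]; split => //.
- case: P0_density => _ _ ->//; apply: integral0_eq => x /= ->//.
- move=> x /= /negP; rewrite -leNgt => px; apply/eqP.
  by rewrite eq_le px p0_ge0.
Qed.

Section perturbation.
Variable F : distr R.
Hypothesis FM : distr_on M F.
Variable t : R.
Hypothesis t_gt0 : 0 < t.
Hypothesis t_le : t <= 2^-1.

(** The ratio p_H / p_F* for H = (1 - t) F* + t F. *)
Let pert x := 1 + t * (mix_ratio F x - 1).

Let pert_ge x : 2^-1 <= pert x.
Proof.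
have r0 := mix_ratio_gt0 x FM; rewrite /pert.
have : 0 <= t * mix_ratio F x by rewrite mulr_ge0 ?ltW.
move: t_le; lra.
Qed.

(** Both sides come from ln (1 + u) <= u, the left one applied to the inverse of [pert x]. Since t
    <= 1/2 keeps [pert x] above 1/2, the quadratic term has the constant 2. *)
Lemma ln_perturbation_bounds x :
  t * (mix_ratio F x - 1) - 2 * t ^+ 2 * (mix_ratio F x - 1) ^+ 2 <= ln (pert x)
  <= t * (mix_ratio F x - 1).
Proof.
have p2 := pert_ge x; have pgt0 : 0 < pert x by lra.
apply/andP; split; last by apply: le_ln1Dx; move: pgt0; rewrite /pert; lra.
have pV0 : 0 < (pert x)^-1 by rewrite invr_gt0.
have : ln (pert x)^-1 <= (pert x)^-1 - 1.
  have := @le_ln1Dx _ ((pert x)^-1 - 1); rewrite subrKC; apply; lra.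
rewrite lnV ?posrE// => H.
have {H} : 1 - (pert x)^-1 <= ln (pert x) by lra.
apply: le_trans.
set s := t * (mix_ratio F x - 1).
have pE : pert x = 1 + s by [].
rewrite (_ : 2 * t ^+ 2 * _ = 2 * s ^+ 2); last by rewrite /s; ring.
have -> : 1 - (pert x)^-1 = s - s ^+ 2 / pert x by rewrite pE; field; rewrite -pE gt_eqF.
rewrite lerD2l lerN2 ler_pdivrMr// -mulrA mulrCA ler_peMr ?sqr_ge0//; lra.
Qed.

Lemma measurable_perturbation : measurable_fun [set: R] (fun x => ln (pert x)).
Proof.
apply: (measurableT_comp (@measurable_ln R)); apply: measurable_funD => //.
by apply: measurable_funM => //; apply: measurable_funB => //; exact: measurable_ratio.
Qed.

Lemma integrable_perturbation : P0.-integrable setT (EFin \o (fun x => ln (pert x))).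
Proof.
apply: (integrable_le_ratio (a := 2) (b := 2) FM) => //.
  exact: measurable_perturbation.
move=> x; have := pert_ge x; have := ln_perturbation_bounds x.
have r0 := mix_ratio_gt0 x FM.
set r := mix_ratio F x in r0 *.
move=> /andP[H1 H2] H3.
have t0 := t_gt0; have t1 := t_le.
rewrite ler_norml; apply/andP; split.
  apply: le_trans H1.
  have tt : t ^+ 2 <= 4^-1 by rewrite expr2; nra.
  have := ler_wpM2r (sqr_ge0 (r - 1)) tt.
  have : - t <= t * (r - 1) by nra.
  by rewrite !expr2; nra.
apply: le_trans H2 _.
have : t * (r - 1) <= r by nra.
by have := sqr_ge0 (r - 1); rewrite !expr2; nra.
Qed.

(** The integral is the loss of F* minus that of the convex combination H, which is again a
    distribution on [- M, M]. *)
Lemma integral_perturbation_le0 : \int[P0]_x ln (pert x) <= 0.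
Proof.
have t01 : 0 <= t <= 1 by apply/andP; split; move: t_gt0 t_le; lra.
have [H HE] := exists_convex_distr Fs F t01.
have HM : distr_on M H.
  rewrite /distr_on/= HE// (FsM : Fs _ = 1%E) (FM : F _ = 1%E).
  by rewrite !mule1 -EFinD subrK.
have pH x : mix_pdf H x = mix_pdf Fs x * pert x.
  rewrite (mix_pdf_convex x t01 HE) /pert /mix_ratio; field.
  by rewrite gt_eqF.
have [_ /(_ H HM)] := Fs_min.
have iu := integrable_perturbation.
have ikl := kl_integrable.
have -> : kl_loss P0 p0 H = (kl_loss P0 p0 Fs - \int[P0]_x (ln (pert x))%:E)%E.
  rewrite /kl_loss -integralB//.
  have mu' : measurable_fun [set: R] (fun x => ln (pert x)) := measurable_perturbation.
  have mg (G : distr R) : measurable_fun [set: R] (fun x => (- ln (mix_pdf G x / p0 x))%:E).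
    apply/measurable_EFinP; apply: measurableT_comp => //; apply: (measurableT_comp (@measurable_ln R)).
    by apply: measurable_funM => //; [exact: measurable_mix_pdf_section|exact: measurable_funV].
  apply: ae_eq_integral => //.
    exact: mg.
    apply: emeasurable_funB; first exact: mg.
    exact/measurable_EFinP.
  case: ae_density_gt0 => N [mN N0 HN]; exists N; split => //.
  apply: subset_trans HN; apply: subsetC => x /= p0x _.
  have px : 0 < pert x by apply: lt_le_trans (pert_ge x); rewrite invr_gt0.
  rewrite -EFinB; congr EFin.
  by rewrite pH mulrAC [in LHS]lnM ?posrE ?divr_gt0// opprD.
have klfin : kl_loss P0 p0 Fs \is a fin_num by exact: integrable_fin_num ikl.
have ufin : (\int[P0]_x (ln (pert x))%:E)%E \is a fin_num by exact: integrable_fin_num iu.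
rewrite -(fineK klfin) -(fineK ufin) -EFinB lee_fin.
rewrite -[X in _ - X]/(\int[P0]_x ln (pert x)); lra.
Qed.

End perturbation.

(** The first-order condition at F* in the direction of F. Instead of differentiating under the
    integral, the quadratic lower bound on the logarithm is integrated, giving Y <= 2 t Q for all
    small t. *)
Lemma integral_ratio_le1 F : distr_on M F -> \int[P0]_x mix_ratio F x <= 1.
Proof.
move=> FM.
have i1 : P0.-integrable setT (EFin \o (fun x => mix_ratio F x - 1)).
  apply: (integrable_le_ratio (a := 2) (b := 2) FM) => //.
    by apply: measurable_funB => //; exact: measurable_ratio.
  move=> x; have := mix_ratio_gt0 x FM; set r := mix_ratio F x => r0.
  rewrite ler_norml; apply/andP; split; nra.
have i2 : P0.-integrable setT (EFin \o (fun x => (mix_ratio F x - 1) ^+ 2)).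
  apply: (integrable_le_ratio (a := 2) (b := 2) FM) => //.
    by apply: measurable_funX; apply: measurable_funB => //; exact: measurable_ratio.
  move=> x; have := mix_ratio_gt0 x FM; set r := mix_ratio F x => r0.
  rewrite ger0_norm ?sqr_ge0//; nra.
have P1 : \int[P0]_x 1 = 1 :> R by rewrite Rintegral_cst//= probability_setT mul1r.
pose Y := \int[P0]_x (mix_ratio F x - 1); pose Q := \int[P0]_x (mix_ratio F x - 1) ^+ 2.
have YE : Y = \int[P0]_x mix_ratio F x - 1.
  rewrite /Y RintegralB//; [by rewrite P1|exact: integrable_ratio|].
  by apply: (integrable_le_ratio (a := 1) (b := 0) FM) => // x; rewrite normr1 mul0r addr0.
have Q0 : 0 <= Q by apply: Rintegral_ge0 => x _; exact: sqr_ge0.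
(* Integrate [ln (1 + t y) >= t y - 2 t^2 y^2] with [y = mix_ratio F x - 1]. *)
have key t : 0 < t -> t <= 2^-1 -> Y <= 2 * t * Q.
  move=> t0 t1.
  suff : t * Y - 2 * t ^+ 2 * Q <= 0.
    rewrite subr_le0 => H; rewrite -(ler_pM2l t0); apply: le_trans H _;
    by rewrite le_eqVlt; apply/orP; left; apply/eqP; ring.
  apply: le_trans (integral_perturbation_le0 FM t0 t1).
  have it : P0.-integrable setT (EFin \o (fun x => t * (mix_ratio F x - 1))).
    by have := integrableZl measurableT t i1.
  have it2 : P0.-integrable setT (EFin \o (fun x => 2 * t ^+ 2 * (mix_ratio F x - 1) ^+ 2)).
    by have := integrableZl measurableT (2 * t ^+ 2) i2.
  rewrite /Y /Q -RintegralZl// -RintegralZl// -RintegralB//.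
  apply: le_Rintegral => //.
  - by have := integrableB measurableT it it2.
  - exact: integrable_perturbation.
  - by move=> x _; have /andP[] := ln_perturbation_bounds FM t0 t1 x.
rewrite -subr_le0 -YE leNgt; apply/negP => Y0.
(* A value of t replacing the limit t -> 0: it is at most 1/2, and 2 t Q < Y. *)
pose t := Y / (4 * (Q + 1) + 2 * Y).
have den : 0 < 4 * (Q + 1) + 2 * Y by lra.
have t0 : 0 < t by rewrite divr_gt0.
have t1 : t <= 2^-1 by rewrite ler_pdivrMr//; lra.
have tden : t * (4 * (Q + 1) + 2 * Y) = Y by rewrite /t divfK// gt_eqF.
have tY : 0 < t * Y by rewrite mulr_gt0.
have tQ : 0 <= t * Q by rewrite mulr_ge0// ltW.
by have := key t t0 t1; nra.
Qed.

(** The weight p0 / p_F* makes d^2 a P0-integral: 2 d^2 = P0 (sqrt r - 1)^2 = P0 r - 2 P0 sqrt r +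
    1, where P0 r <= 1. *)
Lemma integral_sqrt_ratio_le F : distr_on M F ->
  (\int[P0]_x (Num.sqrt (mix_ratio F x))%:E
    <= (1 - weighted_hellinger p0 Fs F Fs ^+ 2)%:E)%E.
Proof.
move=> FM.
have msqrt : measurable_fun [set: R] (fun x => Num.sqrt (mix_ratio F x)).
  have ms : measurable_fun [set: R] (@Num.sqrt R).
    by apply: continuous_measurable_fun; exact: sqrt_continuous.
  by apply: (measurableT_comp ms); exact: measurable_ratio.
have sq x : Num.sqrt (mix_ratio F x) ^+ 2 = mix_ratio F x.
  by rewrite sqr_sqrtr// ltW// mix_ratio_gt0.
have isq : P0.-integrable setT (EFin \o (fun x => Num.sqrt (mix_ratio F x))).
  apply: (integrable_le_ratio (a := 2) (b := 2) FM) => // x.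
  rewrite ger0_norm ?sqrtr_ge0//; have := sq x; have := sqrtr_ge0 (mix_ratio F x).
  set s := Num.sqrt _ => s0 <-.
  by have := sqr_ge0 (s - 1); have := sqr_ge0 (s ^+ 2 - 1); rewrite !expr2; nra.
have ir := integrable_ratio FM.
have i1 : P0.-integrable setT (EFin \o (fun x : R => 1 : R)).
  by apply: (integrable_le_ratio (a := 1) (b := 0) FM) => // x; rewrite normr1 mul0r addr0.
have P1 : \int[P0]_x 1 = 1 :> R by rewrite Rintegral_cst//= probability_setT mul1r.
have dE : weighted_hellinger p0 Fs F Fs ^+ 2 =
    2^-1 * \int[P0]_x ((Num.sqrt (mix_ratio F x) - 1) ^+ 2).
  rewrite /weighted_hellinger sqr_sqrtr; last first.
    rewrite mulr_ge0// ?invr_ge0//; apply: Rintegral_ge0 => x _.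
    by rewrite mulr_ge0 ?sqr_ge0// divr_ge0// ltW.
  congr (_ * _); rewrite /Rintegral integral_P0; first last.
  - by move=> x; rewrite lee_fin sqr_ge0.
  - by apply/measurable_EFinP; apply: measurable_funX; exact: measurable_funB.
  congr fine; apply: eq_integral => x _; rewrite -EFinM; congr EFin.
  have pF0 := mix_pdf_gt0 M_gt0 x FM.
  have s0 : Num.sqrt (mix_pdf Fs x) != 0 by rewrite gt_eqF// sqrtr_gt0.
  rewrite /mix_ratio sqrtrM ?(ltW pF0)// sqrtrV ?(ltW (ps_gt0 x))//.
  rewrite -[in p0 x / _](sqr_sqrtr (ltW (ps_gt0 x))).
  by field.
have rle := integral_ratio_le1 FM.
have dE2 : \int[P0]_x ((Num.sqrt (mix_ratio F x) - 1) ^+ 2) =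
    \int[P0]_x mix_ratio F x - 2 * \int[P0]_x Num.sqrt (mix_ratio F x) + 1.
  rewrite -RintegralZl// -[X in _ + X]P1 -RintegralB//; last first.
    by have := integrableZl measurableT 2 isq.
  rewrite -RintegralD//; last first.
    by have := integrableB measurableT ir (integrableZl measurableT 2 isq).
  apply: eq_Rintegral => x _; have := sq x; move: (Num.sqrt _) => s <-; ring.
have sfin : (\int[P0]_x (Num.sqrt (mix_ratio F x))%:E)%E \is a fin_num.
  exact: integrable_fin_num isq.
rewrite -(fineK sfin) lee_fin dE dE2 -/(Rintegral P0 setT _).
by move: rle; rewrite /Rintegral; lra.
Qed.

End kl_projection.

(** * Posterior contraction *)

Lemma measure_bigsetU_le (R : realType) (d : measure_display) (T : measurableType d)
    (P : {measure set T -> \bar R}) (I : Type) (s : seq I) (F : I -> set T) :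
  (forall i, measurable (F i)) ->
  (P (\big[setU/set0]_(i <- s) F i) <= \sum_(i <- s) P (F i))%E.
Proof.
move=> mF; elim: s => [|i s IH]; first by rewrite !big_nil measure0.
rewrite !big_cons; apply: le_trans (measureU2 _ _ _) _ => //.
  by apply: bigsetU_measurable.
by rewrite leeD2l.
Qed.

Section posterior_bound.
Context (R : realType) (M : R).
Hypothesis M_gt0 : 0 < M.

Lemma measurable_likelihood (n : nat) (x : nat -> R) :
  measurable_fun [set: distr R] (likelihood n x).
Proof.
rewrite (_ : likelihood n x = (fun F => \prod_(i < n) mix_pdf F (x i)))//.
apply: measurable_prod => i _.
have mg : measurable_fun [set: distr R] (fun F : distr R => (F, x i) : (distr R * R)%type).
  by apply: measurable_fun_pair.
exact: (measurableT_comp (@measurable_mix_pdf R) mg).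
Qed.

Lemma likelihood_ge0 (n : nat) (x : nat -> R) (F : distr R) : 0 <= likelihood n x F.
Proof. by apply: prodr_ge0 => i _; exact: mix_pdf_ge0. Qed.

Lemma likelihood_gt0 (n : nat) (x : nat -> R) (F : distr R) : distr_on M F ->
  0 < likelihood n x F.
Proof. by move=> FM; apply: prodr_gt0 => i _; exact: (mix_pdf_gt0 M_gt0). Qed.

Lemma likelihood_ub (n : nat) (x : nat -> R) (F : distr R) : distr_on M F ->
  likelihood n x F <= \prod_(i < n) (normal_peak 1 * expR (- x i ^+ 2 / 2 + M * `|x i|)).
Proof.
move=> FM; apply: ler_prod => i _; rewrite mix_pdf_ge0/=.
exact: (mix_pdf_le M_gt0).
Qed.

Lemma integrable_likelihood (Pi : probability (distr R) R) (n : nat) (x : nat -> R)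
    (B : set (distr R)) : measurable B -> B `<=` distr_on M ->
  Pi.-integrable B (EFin \o likelihood n x).
Proof.
move=> mB BM; apply: measurable_bounded_integrable => //.
- by rewrite (le_lt_trans (probability_le1 Pi mB))// ltry.
- by apply: measurable_funTS; exact: measurable_likelihood.
- exists (\prod_(i < n) (normal_peak 1 * expR (- x i ^+ 2 / 2 + M * `|x i|))); split.
    exact: num_real.
  move=> C HC F BF /=; rewrite ger0_norm ?likelihood_ge0//.
  by rewrite (le_trans _ (ltW HC))// likelihood_ub//; exact: BM.
Qed.

Lemma posterior_ge0 (Pi : probability (distr R) R) (n : nat) (x : nat -> R)
    (B : set (distr R)) : 0 <= posterior M Pi n x B.
Proof.
by rewrite divr_ge0// Rintegral_ge0// => F _; exact: likelihood_ge0.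
Qed.

(** The part of the argument without randomness: the numerator is at most b times the likelihood of
    [Fs], and restricting the denominator to [V] leaves at least v / c times it. *)
Lemma posterior_le (Pi : probability (distr R) R) (n : nat) (x : nat -> R)
    (Fs : distr R) (B V : set (distr R)) (b c v : R) :
  distr_on M Fs -> measurable B -> B `<=` distr_on M ->
  measurable V -> V `<=` distr_on M -> 0 <= b -> 0 < c -> 0 < v -> (v%:E <= Pi V)%E ->
  (forall F, B F -> likelihood n x F <= b * likelihood n x Fs) ->
  (forall F, V F -> likelihood n x Fs <= c * likelihood n x F) ->
  posterior M Pi n x B <= b * c / v.
Proof.
move=> FsM mB BM mV VM b0 c0 v0 vV HB HV.
have L0 := likelihood_gt0 n x FsM; set L := likelihood n x Fs in L0 HB HV.
have num : \int[Pi]_(F in B) likelihood n x F <= b * L.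
  apply: (@le_trans _ _ (\int[Pi]_(F in B) (cst (b * L) F))).
    apply: le_Rintegral => //; first exact: integrable_likelihood.
    apply: measurable_bounded_integrable => //.
      by rewrite (le_lt_trans (probability_le1 Pi mB))// ltry.
    exact: bounded_cst.
  rewrite Rintegral_cst// ler_piMr ?mulr_ge0 ?(ltW L0)//.
  by rewrite -lee_fin fineK ?fin_num_measure// probability_le1.
have den : L / c * v <= \int[Pi]_(F in distr_on M) likelihood n x F.
  apply: (@le_trans _ _ (\int[Pi]_(F in V) (cst (L / c) F))).
    rewrite Rintegral_cst// ler_wpM2l ?divr_ge0 ?(ltW L0) ?(ltW c0)//.
    by rewrite -lee_fin fineK ?fin_num_measure.
  apply: (@le_trans _ _ (\int[Pi]_(F in V) likelihood n x F)).
    apply: le_Rintegral => //.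
    - apply: measurable_bounded_integrable => //.
        by rewrite (le_lt_trans (probability_le1 Pi mV))// ltry.
      exact: bounded_cst.
    - exact: integrable_likelihood.
    - by move=> F VF; rewrite ler_pdivrMr// mulrC HV.
  have mDM := @measurable_distr_on R M.
  have iD := integrable_likelihood Pi n x mDM (fun F FM => FM).
  rewrite /Rintegral fine_le//.
  - by apply: integrable_fin_num => //; exact: integrable_likelihood.
  - exact: integrable_fin_num.
  - apply: ge0_subset_integral => //.
    + by apply/measurable_EFinP; apply: measurable_funTS; exact: measurable_likelihood.
    + by move=> F _; rewrite lee_fin likelihood_ge0.
have den0 : 0 < L / c * v by rewrite mulr_gt0// divr_gt0.
rewrite /posterior ler_pdivrMr ?(lt_le_trans den0)//.
apply: le_trans num _.
apply: (@le_trans _ _ (b * c / v * (L / c * v))).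
  by rewrite le_eqVlt; apply/orP; left; apply/eqP; field; rewrite !gt_eqF.
by rewrite ler_wpM2l// !mulr_ge0 ?invr_ge0 ?(ltW c0) ?(ltW v0).
Qed.

Lemma measurable_posterior (Pi : probability (distr R) R)
    (d : measure_display) (Om : measurableType d) (P : probability Om R)
    (X : nat -> {RV P >-> R}) (n : nat) (B : set (distr R)) : measurable B ->
  measurable_fun [set: Om] (fun w => posterior M Pi n (fun i => X i w) B).
Proof.
move=> mB; apply: measurable_funM; first exact: measurable_integral_likelihood.
apply: measurable_funV; apply: measurable_integral_likelihood.
exact: measurable_distr_on.
Qed.

End posterior_bound.

Lemma expR_prod_1Dn (R : realType) (n : nat) : (0 < n)%N ->
  (1 + n%:R^-1) ^+ n <= expR 1 :> R.
Proof.
move=> n0; have -> : 1 = n%:R * n%:R^-1 :> R by rewrite divff// pnatr_eq0 -lt0n.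
rewrite expRM_natl divff ?pnatr_eq0 -?lt0n//.
by rewrite lerXn2r ?nnegrE ?expR_ge0 ?addr_ge0 ?invr_ge0// expR_ge1Dx.
Qed.

(** * Finite coverings of the mixtures by moments *)

Section covering.
Context (R : realType) (M : R).
Hypothesis M_gt0 : 0 < M.

(* On [|x| <= L], moments up to order [degree_rate * L] known with precision
   [exp (- moment_rate * L)] determine mixture densities up to a factor [1 + exp (- L)]. *)
Definition moment_rate : R := 2 * M + M ^+ 2 / 2 + 2.
Definition degree_rate : R := (expR 1 + 1) * M + M ^+ 2 / 2 + 3.

Lemma moment_rate_gt0 : 0 < moment_rate.
Proof. by rewrite /moment_rate; have := sqr_ge0 M; move: M_gt0; lra. Qed.

Lemma degree_rate_gt0 : 0 < degree_rate.
Proof.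
have H : 0 <= (expR 1 + 1) * M by rewrite mulr_ge0 ?addr_ge0 ?expR_ge0 ?(ltW M_gt0).
by rewrite /degree_rate; have := sqr_ge0 M; move: H; lra.
Qed.

Definition degree (L : R) : nat := (Num.truncn (degree_rate * L)).+1.

Lemma degree_ge (L : R) : degree_rate * L <= (degree L)%:R.
Proof. exact/ltW/truncnS_gt. Qed.

Lemma degree_le (L : R) : 1 <= L -> (degree L)%:R <= (degree_rate + 1) * L.
Proof.
move=> L1; have c0 := degree_rate_gt0.
have /andP[H _] := truncn_itv (mulr_ge0 (ltW c0) (le_trans ler01 L1)).
by rewrite /degree -natr1 [leRHS]mulrDl mul1r lerD.
Qed.

Lemma expRN1_le_half (R' : realType) : expR (- 1) <= 2^-1 :> R'.
Proof.
rewrite expRN lef_pV2 ?posrE ?expR_gt0//.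
by have := expR_ge1Dx (1 : R'); lra.
Qed.

(** The two rates are calibrated here. Let E be exp(- L) times the lower bound exp(- L M - M^2/2) of
    the Laplace factor: the moment error is at most E/e <= E/2, and each of the two Taylor
    remainders at most E/e^2 <= E/4. As L >= 1, additive constants are absorbed into multiples of
    L. *)
Lemma mix_pdf_uniformly_close (F G : distr R) (L eta x : R) : 1 <= L ->
  distr_on M F -> distr_on M G -> 0 <= eta <= expR (- (moment_rate * L)) ->
  (forall k, (k < degree L)%N -> `|gauss_moment M k F - gauss_moment M k G| <= eta) ->
  `|x| <= L -> mix_pdf F x <= (1 + expR (- L)) * mix_pdf G x.
Proof.
move=> L1 FM GM /andP[eta0 etaL] FG xL.
apply: (mix_pdf_close M_gt0 FM GM xL eta0 FG).
set E := expR (- L) * _.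
have EE : E = expR (- L - L * M - M ^+ 2 / 2).
  by rewrite /E -expRD mulNr addrA.
have M2 := sqr_ge0 M.
have ML : M <= M * L by rewrite ler_peMr// ltW.
have M2L : M ^+ 2 / 2 <= M ^+ 2 / 2 * L by rewrite ler_peMr// divr_ge0.
have h1 := expRN1_le_half R.
have A1 : eta * expR (M * L) <= expR (- 1) * E.
  apply: (@le_trans _ _ (expR (- (moment_rate * L)) * expR (M * L))).
    by rewrite ler_wpM2r ?expR_ge0.
  by rewrite EE -!expRD ler_expR /moment_rate; lra.
have A2 : expR (expR 1 * (M * L) - (degree L)%:R) <= expR (- 1) * expR (- 1) * E.
  rewrite EE -!expRD ler_expR; have := degree_ge L; rewrite /degree_rate; lra.
have E0 : 0 < E by rewrite EE expR_gt0.
have e0 : 0 < expR (- 1) :> R by exact: expR_gt0.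
have A3 : expR (- 1) * E <= 2^-1 * E by rewrite ler_wpM2r// ltW.
have A4 : expR (- 1) * expR (- 1) * E <= 2^-1 * 2^-1 * E.
  by rewrite ler_wpM2r ?(ltW E0)// ler_pM// ltW.
by lra.
Qed.

Definition covering_rate : R := (moment_rate + 2) * (degree_rate + 1).

(** The moments lie in [- 1, 1] and are rounded to a grid of step [eta]. This gives m^K classes,
    with K = O(L) moments and m = exp(O(L)) grid points. An index map instead of a list of centres
    leaves the choice of representatives to the caller. *)
Lemma exists_covering (L : R) : 1 <= L ->
  exists (J : finType) (idx : distr R -> J),
    #|J|%:R <= expR (covering_rate * L ^+ 2) /\
    forall F G x, distr_on M F -> distr_on M G -> idx F = idx G -> `|x| <= L ->
      mix_pdf F x <= (1 + expR (- L)) * mix_pdf G x.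
Proof.
move=> L1.
have L0 : 0 < L by apply: lt_le_trans L1.
pose eta := expR (- (moment_rate * L)).
have eta0 : 0 < eta by exact: expR_gt0.
pose m := (Num.truncn (2 / eta)).+1.
pose pos (F : distr R) (k : nat) : R := (gauss_moment M k F + 1) / eta.
have pos_itv F k : distr_on M F -> 0 <= pos F k /\ pos F k <= 2 / eta.
  move=> FM; have : `|gauss_moment M k F| <= 1.
    apply: le_distr_on_Rintegral => //; first exact: measurable_moment_fun.
    exact: moment_fun_le1.
  rewrite ler_norml => /andP[k1 k2]; split.
    by rewrite divr_ge0 ?(ltW eta0)//; lra.
  by rewrite ler_wpM2r ?invr_ge0 ?(ltW eta0)//; lra.
pose idx (F : distr R) : {ffun 'I_(degree L) -> 'I_m} :=
  (* For F on [- M, M] the rounded position is below m, so the default value of [inord] does not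
     occur. *)
  [ffun k => inord (Num.truncn (pos F (nat_of_ord k)))].
exists {ffun 'I_(degree L) -> 'I_m}, idx; split.
  rewrite card_ffun !card_ord natrX.
  have mL : m%:R <= expR ((moment_rate + 2) * L).
    have /andP[H _] := truncn_itv (divr_ge0 (ler0n R 2) (ltW eta0)).
    have eta1 : 1 <= eta^-1.
      by rewrite -expRN opprK -[leLHS]expR0 ler_expR mulr_ge0 ?(ltW moment_rate_gt0) ?(ltW L0).
    apply: (@le_trans _ _ (3 * eta^-1)); first by rewrite /m -natr1; lra.
    rewrite [in leRHS]mulrDl expRD -expRN opprK mulrC ler_wpM2l ?expR_ge0//.
    apply: (@le_trans _ _ (1 + 2 * L)); first by lra.
    exact: expR_ge1Dx.
  apply: (@le_trans _ _ (expR ((moment_rate + 2) * L) ^+ degree L)).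
    by rewrite lerXn2r ?nnegrE ?expR_ge0.
  rewrite -expRM_natl ler_expR /covering_rate.
  have c0 := moment_rate_gt0.
  apply: (@le_trans _ _ ((degree_rate + 1) * L * ((moment_rate + 2) * L))).
    by rewrite ler_wpM2r ?degree_le// mulr_ge0 ?(ltW L0)//; lra.
  by rewrite le_eqVlt; apply/orP; left; apply/eqP; ring.
move=> F G x FM GM FG xL.
apply: (mix_pdf_uniformly_close (eta := eta) L1 FM GM _ _ xL).
  by rewrite (ltW eta0)/=.
move=> k kd.
have [F0 F2] := pos_itv F k FM; have [G0 G2] := pos_itv G k GM.
have tr H : 0 <= H -> H <= 2 / eta -> (Num.truncn H < m)%N.
  by move=> H0 H2; rewrite ltnS le_truncn.
have : Num.truncn (pos F k) = Num.truncn (pos G k).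
  move/ffunP/(_ (Ordinal kd)): FG; rewrite !ffunE/= => /(congr1 val)/=.
  by rewrite !inordK ?tr.
move=> FGk; have /andP[f1 f2] := truncn_itv F0; have /andP[g1 g2] := truncn_itv G0.
rewrite FGk in f1 f2; rewrite -natr1 in f2 g2.
have E : gauss_moment M k F - gauss_moment M k G = (pos F k - pos G k) * eta.
  by rewrite /pos; field; rewrite gt_eqF.
rewrite E normrM (gtr0_norm eta0) ler_piMl ?(ltW eta0)//.
by rewrite ler_norml; apply/andP; split; lra.
Qed.

End covering.

(** * Prior mass of the neighbourhoods of the minimizer *)

Section prior_small_ball.
Context (R : realType) (M : R).
Hypothesis M_gt0 : 0 < M.
Notation D := `[- M, M]%classic.
Variables (alpha : {finite_measure set (measurableTypeR R) -> \bar R}) (a : R -> R).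
Hypothesis a_continuous : {within D, continuous a}.
Hypothesis a_gt0 : forall x, x \in `[- M, M] -> 0 < a x.
Hypothesis alpha_density : forall A : set R, measurable A ->
  alpha A = (\int[@lebesgue_measure R]_(x in A `&` D) (a x)%:E)%E.

Lemma exists_density_lower_bound : exists2 amin : R, 0 < amin & forall x, D x -> amin <= a x.
Proof.
have MM : - M <= M by move: M_gt0; lra.
have [c cM cmin] := EVT_min MM a_continuous.
by exists (a c) => [|x Dx]; [exact: a_gt0|exact: cmin].
Qed.

(** Moves multiplicative constants into the exponent, where they become multiples of L. *)
Lemma le_expRM (x : R) (y : R) : 1 <= y -> x <= expR (x * y).
Proof.
move=> y1; have [x0|x0] := leP x 0; first by rewrite (le_trans x0)// expR_ge0.
apply: (@le_trans _ _ (1 + x)); first by lra.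
by apply: le_trans (expR_ge1Dx x) _; rewrite ler_expR -[leLHS]mulr1 ler_wpM2l ?(ltW x0).
Qed.

(** With radius and mesh both powers of exp(- L), one cell costs a factor exp(- O(L)); the O(L)
    cells together then cost exp(- O(L^2)). In the constant, (ce + 1)(A + 1) pays for (e/2)^(A+1),
    using 1/2 >= exp(- L), then 2 for exp(- 2), and cm + cg for [gamma_fun_bound]. *)
Lemma ball_prob_lower (amin A ce cm : R) : 0 < amin -> 1 <= A -> 0 <= ce -> 0 <= cm ->
  exists2 cb : R, 0 <= cb & forall L : R, 1 <= L ->
    expR (- (cb * L)) <=
      ball_prob M amin A (expR (- (ce * L))) (Num.truncn (expR (cm * L))).+1.
Proof.
move=> amin0 A1 ce0 cm0.
have A0 : 0 < A by lra.
pose cg := 2 / (amin * M) + 2 * (2 * A) `^ A.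
have aM0 : 0 < amin * M by rewrite mulr_gt0.
have cg0 : 0 <= cg.
  by rewrite addr_ge0 ?divr_ge0 ?(ltW aM0)// mulr_ge0 ?powR_ge0.
exists ((ce + 1) * (A + 1) + 2 + cm + cg).
  have : 0 <= (ce + 1) * (A + 1) by apply: mulr_ge0; lra.
  lra.
move=> L L1; have L0 : 0 < L by lra.
set m := (Num.truncn _).+1.
have E1 : 1 <= expR (cm * L) by rewrite -[leLHS]expR0 ler_expR mulr_ge0// ltW.
have m_le : m%:R <= 2 * expR (cm * L).
  have /andP[H _] := truncn_itv (expR_ge0 (cm * L)).
  by rewrite /m -natr1; lra.
have m1 : 1 <= m%:R :> R by rewrite ler1n.
have mesh_ge : M * expR (- (cm * L)) <= mesh M m.
  rewrite /mesh ler_pdivlMr; last by lra.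
  rewrite expRN; set E := expR (cm * L) in E1 m_le *.
  have EV : 0 < E^-1 by rewrite invr_gt0; lra.
  rewrite -mulrA [leRHS]mulrC ler_wpM2l ?(ltW M_gt0)//.
  rewrite mulrC ler_pdivrMr; lra.
rewrite /ball_prob ler_pdivlMr; last first.
  rewrite /gamma_fun_bound ltr_pwDl ?invr_gt0 ?mulr_ge0 ?powR_ge0//.
  by rewrite mulr_gt0// divr_gt0// mesh_gt0.
have B : gamma_fun_bound A (amin * (mesh M m / 2)) <= expR ((cm + cg) * L).
  rewrite mulrDl expRD; apply: (@le_trans _ _ (expR (cm * L) * cg)); last first.
    by rewrite ler_wpM2l ?expR_ge0// le_expRM.
  rewrite /gamma_fun_bound /cg mulrDr lerD//; last first.
    by rewrite ler_peMl// mulr_ge0 ?powR_ge0.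
  apply: (@le_trans _ _ ((amin * (M * expR (- (cm * L)) / 2))^-1)).
    rewrite lef_pV2 ?posrE.
    - by rewrite ler_pM2l// ler_pM2r ?invr_gt0.
    - by rewrite mulr_gt0// divr_gt0// mesh_gt0.
    - by rewrite mulr_gt0// divr_gt0// mulr_gt0 ?expR_gt0.
  rewrite expRN le_eqVlt; apply/orP; left; apply/eqP; field.
  by rewrite !gt_eqF ?expR_gt0.
apply: (@le_trans _ _ (expR (- (((ce + 1) * (A + 1) + 2 + cm + cg) * L)) * expR ((cm + cg) * L))).
  by rewrite ler_wpM2l ?expR_ge0.
rewrite -expRD (_ : _ + _ = - ((ce + 1) * L) * (A + 1) + - 2 * L); last by ring.
rewrite expRD; apply: ler_pM; rewrite ?expR_ge0//; last by rewrite ler_expR; lra.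
rewrite expRM; apply: ge0_ler_powR; rewrite ?nnegrE ?expR_ge0 ?divr_ge0 ?expR_ge0//; first by lra.
rewrite mulrDl mul1r opprD expRD ler_wpM2l ?expR_ge0//.
apply: le_trans (expRN1_le_half R); rewrite ler_expR; lra.
Qed.

Lemma exists_prior_ball (Pi : probability (distr R) R) (Fs : distr R) :
  dirichlet_process M alpha Pi -> distr_on M Fs ->
  exists2 C : R, 0 <= C & forall L : R, 1 <= L ->
    exists V : set (distr R), [/\ measurable V, V `<=` distr_on M,
      ((expR (- (C * L ^+ 2)))%:E <= Pi V)%E &
      forall F x, V F -> `|x| <= L -> mix_pdf Fs x <= (1 + expR (- L)) * mix_pdf F x].
Proof.
move=> DP FsM.
have [amin amin0 amin_le] := exists_density_lower_bound.
pose A := 1 + fine (alpha setT).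
have A1 : 1 <= A by rewrite lerDl fine_ge0.
have alpha_le : (alpha setT <= A%:E)%E.
  by rewrite EFinD fineK ?fin_num_measure// leeDr.
set ceta := moment_rate M; set cK := degree_rate M.
have ceta0 : 0 < ceta by exact: moment_rate_gt0.
have cK0 : 0 < cK by exact: degree_rate_gt0.
(* Both constants have three summands: the first pays for powers of L through L <= exp(L), [ceta]
   produces the factor [eta], and the last absorbs a numerical factor by [le_expRM]. The mesh error
   and the mass error are then at most [eta] / 2 each. *)
pose cm := 1 + ceta + 16 * (cK + 1 + M ^+ 2).
pose ce := 2 + ceta + 4 * (cK + 3) ^+ 2.
have M20 := sqr_ge0 M.
have cK20 := sqr_ge0 (cK + 3).
have cm0 : 0 <= cm by rewrite /cm; lra.
have ce0 : 0 <= ce by rewrite /ce; lra.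
have [cb cb0 Hcb] := ball_prob_lower amin0 A1 ce0 cm0.
exists (cb * (cK + 3)); first by rewrite mulr_ge0//; lra.
move=> L L1; have L0 : 0 < L by lra.
set K := degree M L.
set m := (Num.truncn (expR (cm * L))).+1.
pose e := expR (- (ce * L)); pose eta := expR (- (ceta * L)).
have e0 : 0 < e by exact: expR_gt0.
have eta0 : 0 < eta by exact: expR_gt0.
have eta1 : eta <= 1.
  by rewrite /eta -[leRHS]expR0 ler_expR oppr_le0 mulr_ge0// ltW.
have L_le : L <= expR L by have := le_expRM 1 L1; have := expR_ge1Dx L; lra.
have KL : K%:R <= (cK + 1) * L := degree_le M_gt0 L1.
have K2L : K.+2%:R <= (cK + 3) * L.
  by rewrite -addn2 natrD; move: KL; lra.
have Ke : 4 * K.+2%:R ^+ 2 * e <= eta.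
  apply: (@le_trans _ _ (4 * ((cK + 3) * expR L) ^+ 2 * e)).
    rewrite ler_wpM2r ?(ltW e0)// ler_wpM2l// lerXn2r ?nnegrE ?mulr_ge0 ?expR_ge0//; first by lra.
    by apply: le_trans K2L _; rewrite ler_wpM2l//; lra.
  have -> : e = expR (- L) ^+ 2 * eta * expR (- (4 * (cK + 3) ^+ 2 * L)).
    by rewrite /e /eta -expRM_natl -!expRD /ce; congr expR; ring.
  have E : expR L * expR (- L) = 1 by rewrite -expRD subrr expR0.
  rewrite [leLHS](_ : _ = (expR L * expR (- L)) ^+ 2 * eta *
    (4 * (cK + 3) ^+ 2 * expR (- (4 * (cK + 3) ^+ 2 * L)))); last by ring.
  rewrite E expr1n mul1r ler_piMr ?(ltW eta0)//.
  by rewrite expRN ler_pdivrMr ?expR_gt0// mul1r le_expRM.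
have Ke1 : K.+2%:R * e <= 1.
  apply: le_trans eta1; apply: le_trans Ke; rewrite ler_wpM2r ?(ltW e0)//.
  have : 1 <= K.+2%:R :> R by rewrite ler1n.
  by set k := K.+2%:R; rewrite expr2; nra.
have m1 : 1 <= m%:R :> R by rewrite ler1n.
have mesh_le : 2 * (K%:R / M + M) * mesh M m <= eta / 2.
  have m_ge : expR (cm * L) <= m%:R by exact/ltW/truncnS_gt.
  have H1 : mesh M m <= 4 * M * expR (- (cm * L)).
    rewrite /mesh expRN ler_wpM2l//; first by move: M_gt0; lra.
    rewrite lef_pV2 ?posrE ?expR_gt0//; lra.
  apply: (@le_trans _ _ (2 * (K%:R / M + M) * (4 * M * expR (- (cm * L))))).
    rewrite ler_wpM2l// mulr_ge0// addr_ge0 ?divr_ge0 ?(ltW M_gt0)//.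
  rewrite [leLHS](_ : _ = 8 * (K%:R + M ^+ 2) * expR (- (cm * L))); last first.
    by field; rewrite gt_eqF.
  apply: (@le_trans _ _ (8 * ((cK + 1 + M ^+ 2) * expR L) * expR (- (cm * L)))).
    rewrite ler_wpM2r ?expR_ge0// ler_wpM2l//.
    rewrite mulrDl lerD//.
      by apply: le_trans KL _; rewrite ler_wpM2l//; lra.
    by rewrite ler_peMr// (le_trans L1).
  have -> : expR (- (cm * L)) = expR (- L) * eta * expR (- (16 * (cK + 1 + M ^+ 2) * L)).
    by rewrite /eta -!expRD /cm; congr expR; ring.
  have E : expR L * expR (- L) = 1 by rewrite -expRD subrr expR0.
  rewrite [leLHS](_ : _ = (expR L * expR (- L)) * (eta / 2) *
    (16 * (cK + 1 + M ^+ 2) * expR (- (16 * (cK + 1 + M ^+ 2) * L)))); last by field.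
  rewrite E mul1r ler_piMr ?divr_ge0 ?(ltW eta0)//.
  by rewrite expRN ler_pdivrMr ?expR_gt0// mul1r le_expRM.
have [V [mV VM PiV FV]] := dirichlet_process_moment_ball M_gt0 a_continuous
  alpha_density amin0 amin_le A1 alpha_le DP FsM (ltn0Sn _ : (0 < m)%N) e0 Ke1.
exists V; split => //.
- apply: le_trans PiV; rewrite lee_fin.
  apply: (@le_trans _ _ (expR (- (cb * L)) ^+ K.+2)); last first.
    by rewrite lerXn2r ?nnegrE ?expR_ge0 ?Hcb// ball_prob_ge0.
  rewrite -expRM_natl ler_expR mulrN lerN2.
  apply: (@le_trans _ _ ((cK + 3) * L * (cb * L))).
    by rewrite ler_wpM2r// mulr_ge0// ltW.
  by rewrite le_eqVlt; apply/orP; left; apply/eqP; ring.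
- move=> F x VF xL.
  apply: (mix_pdf_uniformly_close M_gt0 (eta := eta) L1 FsM (VM _ VF) _ _ xL).
    by rewrite (ltW eta0)/=.
  move=> k kK; rewrite distrC; apply: le_trans (FV F VF k kK) _; lra.
Qed.

End prior_small_ball.

(** * Deviations of likelihood ratios and of the posterior *)

Section deviation.
Context (R : realType) (d : measure_display) (Om : measurableType d).
Variable P : probability Om R.

Variables (M : R) (P0 : distr R) (p0 : R -> R) (Fs : distr R).
Hypothesis M_gt0 : 0 < M.
Hypothesis P0_density : has_density P0 p0.
Hypothesis Fs_min : is_kl_minimizer M P0 p0 Fs.
Hypothesis p0_bounded : (fun x => p0 x / mix_pdf Fs x)
  \in Lfun (@lebesgue_measure R) +oo%E.
Variable X : nat -> {RV P >-> R}.
Hypothesis X_iid : iid X P0.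

Lemma markov_ge0 (f : Om -> R) (s : R) : measurable_fun [set: Om] f ->
  (forall w, 0 <= f w) -> 0 < s ->
  (P [set w | (s < f w)%R] <= (s^-1)%:E * \int[P]_w (f w)%:E)%E.
Proof.
move=> mf f0 s0.
have mS : measurable [set w | s < f w].
  rewrite (_ : [set w | _] = f @^-1` `]s, +oo[%classic); last first.
    by apply/seteqP; split => x /=; rewrite in_itv/= andbT.
  by rewrite -[X in measurable X]setTI; apply: mf.
have -> : P [set w | s < f w] = (\int[P]_w (\1_[set w | s < f w] w)%:E)%E.
  by rewrite integral_indic// setIT.
rewrite -ge0_integralZl//; first last.
- by rewrite lee_fin invr_ge0 ltW.
- by move=> w _; rewrite lee_fin.
- exact/measurable_EFinP.
apply: ge0_le_integral => //.
- by apply/measurable_EFinP; exact: measurable_indic.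
- by apply: measurable_funeM; exact/measurable_EFinP.
- move=> w _; rewrite -EFinM lee_fin indicE.
  have [|_] := boolP (w \in _).
    by rewrite inE/= => sw; rewrite mulrC ler_pdivlMr// mul1r ltW.
  by rewrite mulr_ge0// invr_ge0 ltW.
Qed.

Lemma integral_iid (f : R -> R) (i : nat) : measurable_fun [set: R] f ->
  (forall x, 0 <= f x) ->
  (\int[P]_w (f (X i w))%:E = \int[P0]_x (f x)%:E)%E.
Proof.
move=> mf f0.
have -> : (\int[P]_w (f (X i w))%:E = \int[P]_w ((f (X i w))%:E * 1%:E))%E.
  by apply: eq_integral => w _; rewrite mule1.
rewrite (ge0_integral_weighted_pushforward (f := EFin \o f) (h := fun=> 1)
  (c := 1) (nu := P0) (measurable_funP (X i)))//.
- by rewrite mul1e.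
- move=> B mB; rewrite mul1e; under eq_integral do rewrite mule1.
  transitivity (distribution P (X i) B); last by case: X_iid => _ ->.
  rewrite -[X in X = _]/(\int[P]_w (\1_(X i @^-1` B) w)%:E)%E integral_indic//.
    by rewrite setIT.
  by rewrite -[X in measurable X]setTI; exact: measurable_funP.
- exact/measurable_EFinP.
Qed.

Lemma measurable_sqrt_ratio F :
  measurable_fun [set: R] (fun x => Num.sqrt (mix_ratio Fs F x)).
Proof.
have ms : measurable_fun [set: R] (@Num.sqrt R).
  by apply: continuous_measurable_fun; exact: sqrt_continuous.
by apply: (measurableT_comp ms); exact: measurable_ratio.
Qed.

(** Markov's inequality for a product of independent factors, each of mean at most 1 - d^2 <= exp(-
    d^2). *)
Lemma sqrt_likelihood_ratio_deviation (F : distr R) (n : nat) (s : R) :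
  distr_on M F -> 0 < s ->
  (P [set w | (s < \prod_(i < n) Num.sqrt (mix_ratio Fs F (X i w)))%R]
    <= (s^-1 * expR (- (n%:R * weighted_hellinger p0 Fs F Fs ^+ 2)))%:E)%E.
Proof.
move=> FM s0; have mr := measurable_sqrt_ratio F.
have mprod : measurable_fun [set: Om]
    (fun w => \prod_(i < n) Num.sqrt (mix_ratio Fs F (X i w))).
  by apply: measurable_prod => i _; exact: (measurableT_comp mr).
have Hs := integral_sqrt_ratio_le M_gt0 P0_density Fs_min p0_bounded FM.
apply: le_trans (markov_ge0 mprod _ s0) _.
  by move=> w; apply: prodr_ge0 => i _; exact: sqrtr_ge0.
rewrite EFinM lee_wpmul2l ?lee_fin ?invr_ge0 ?(ltW s0)//.
rewrite (mutually_independent_expectation_prod n (f := fun=> fun x => Num.sqrt (mix_ratio Fs F x))).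
- under eq_bigr do rewrite (integral_iid _ mr (fun x => sqrtr_ge0 _)).
  rewrite -mulrN expRM_natl -[n in leRHS]card_ord -prodr_const -prodEFin.
  suff : (0 <= \prod_(i < n) \int[P0]_x (Num.sqrt (mix_ratio Fs F x))%:E
      <= \prod_(i < n) (expR (- weighted_hellinger p0 Fs F Fs ^+ 2))%:E)%E.
    by move=> /andP[].
  elim/big_rec2: _ => [|i x y _ /andP[y0 yx]]; first by rewrite lee01 lexx.
  have I0 : (0 <= \int[P0]_x (Num.sqrt (mix_ratio Fs F x))%:E)%E.
    by apply: integral_ge0 => z _; rewrite lee_fin sqrtr_ge0.
  rewrite mule_ge0//= lee_pmul//.
  apply: le_trans Hs _; rewrite lee_fin.
  by have := expR_ge1Dx (- weighted_hellinger p0 Fs F Fs ^+ 2).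
- by case: X_iid.
- by move=> _; exact: mr.
- by move=> _ x; exact: sqrtr_ge0.
- move=> i; rewrite (integral_iid _ mr (fun x => sqrtr_ge0 _)).
  by apply: le_lt_trans Hs _; rewrite ltry.
Qed.

Lemma max_deviation (C : R) (n : nat) (L : R) :
  (forall T : R, (P0 [set x | (T < `|x|)%R] <= (C * expR (- 2 * T))%:E)%E) ->
  expR L = n%:R ->
  (P (\big[setU/set0]_(i < n) [set w | (L < `|X i w|)%R]) <= (C * expR (- L))%:E)%E.
Proof.
move=> HC Ln.
have mT : measurable [set x : R | L < `|x|].
  rewrite (_ : [set x | _] = (fun x : R => `|x|) @^-1` `]L, +oo[%classic); last first.
    by apply/seteqP; split => x /=; rewrite in_itv/= andbT.
  by rewrite -[X in measurable X]setTI; apply: normr_measurable.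
have mA (i : nat) : measurable (X i @^-1` [set x : R | L < `|x|]).
  by rewrite -[X in measurable X]setTI; exact: (measurable_funP (X i)).
apply: le_trans (measure_bigsetU_le _ _ _) _ => [i|]; first exact: mA.
apply: (@le_trans _ _ (\sum_(i < n) (C * expR (- 2 * L))%:E)%E).
  apply: lee_sum => i _; apply: le_trans (HC L).
  by rewrite -(proj2 X_iid i _ mT).
rewrite sumEFin lee_fin sumr_const card_ord -[leLHS]mulr_natr -Ln -mulrA -expRD.
by rewrite (_ : - 2 * L + L = - L)//; ring.
Qed.

Lemma likelihood_close (F G : distr R) (n : nat) (x : nat -> R) (L : R) :
  distr_on M G -> (0 < n)%N -> expR L = n%:R ->
  (forall i, (i < n)%N -> mix_pdf F (x i) <= (1 + expR (- L)) * mix_pdf G (x i)) ->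
  likelihood n x F <= expR 1 * likelihood n x G.
Proof.
move=> GM n0 Ln H.
apply: (@le_trans _ _ (\prod_(i < n) ((1 + n%:R^-1) * mix_pdf G (x i)))).
  by apply: ler_prod => i _; rewrite mix_pdf_ge0/= -Ln -expRN H.
rewrite big_split/= prodr_const card_ord ler_wpM2r ?likelihood_ge0//.
exact: expR_prod_1Dn.
Qed.

Lemma posterior_deviation (Pi : probability (distr R) R) (C1 C2 C3 : R) (n : nat)
    (L kappa eps : R) (V : set (distr R)) (J : finType) (idx : distr R -> J) :
  (0 < n)%N -> expR L = n%:R -> 0 <= kappa -> 0 <= L ->
  (forall T : R, (P0 [set x | (T < `|x|)%R] <= (C3 * expR (- 2 * T))%:E)%E) ->
  #|J|%:R <= expR (C1 * L ^+ 2) ->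
  (forall F G x, distr_on M F -> distr_on M G -> idx F = idx G -> `|x| <= L ->
      mix_pdf F x <= (1 + expR (- L)) * mix_pdf G x) ->
  measurable V -> V `<=` distr_on M -> ((expR (- (C2 * L ^+ 2)))%:E <= Pi V)%E ->
  (forall F x, V F -> `|x| <= L -> mix_pdf Fs x <= (1 + expR (- L)) * mix_pdf F x) ->
  expR (2 + (C2 - kappa ^+ 2) * L ^+ 2) <= eps ->
  (P [set w | (eps < `|posterior M Pi n (fun i => X i w)
       [set F | distr_on M F /\
          (kappa * (L / Num.sqrt n%:R) < weighted_hellinger p0 Fs F Fs)%R] - 0|)%R]
    <= (C3 * expR (- L) + expR ((C1 - kappa ^+ 2 / 2) * L ^+ 2))%:E)%E.
Proof.
move=> n0 Ln k0 L0 HC3 HJ Hidx mV VM PiV HV Heps.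
set B := [set F : distr R | distr_on M F /\ _].
have nR0 : 0 < n%:R :> R by rewrite ltr0n.
have FsM : distr_on M Fs by case: Fs_min.
have [mp0 p00 _] := P0_density.
have mB : measurable B.
  have -> : B = distr_on M `&` ((fun F => weighted_hellinger p0 Fs F Fs) @^-1`
      `]kappa * (L / Num.sqrt n%:R), +oo[%classic).
    by apply/seteqP; split => F /=; rewrite in_itv/= andbT.
  apply: measurableI; first exact: measurable_distr_on.
  rewrite -[X in measurable X]setTI.
  by apply: (measurable_weighted_hellinger Fs mp0 p00).
have BM : B `<=` distr_on M by move=> F [].
have dB F : B F -> kappa ^+ 2 * L ^+ 2 <= n%:R * weighted_hellinger p0 Fs F Fs ^+ 2.
  move=> [_ dF].
  have q0 : 0 <= kappa * (L / Num.sqrt n%:R).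
    by rewrite mulr_ge0// divr_ge0// sqrtr_ge0.
  have : (kappa * (L / Num.sqrt n%:R)) ^+ 2 <= weighted_hellinger p0 Fs F Fs ^+ 2.
    by rewrite lerXn2r ?nnegrE ?(ltW dF)// (le_trans q0)// ltW.
  rewrite !exprMn exprVn sqr_sqrtr ?(ltW nR0)// => H.
  apply: le_trans (ler_wpM2l (ltW nR0) H).
  by rewrite le_eqVlt; apply/orP; left; apply/eqP; field; rewrite gt_eqF.
(* The threshold balances Markov's inequality: s^-1 exp(- kappa^2 L^2) = s. Off the exceptional
   event the likelihood ratio itself is at most s^2. *)
pose s := expR (- (kappa ^+ 2 * L ^+ 2 / 2)).
have s0 : 0 < s by exact: expR_gt0.
(* Representatives are chosen inside [B], so that each of them is at distance more than kappa L /
   sqrt n; classes that miss [B] get none. Only finitely many choices are made, and the classes need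
   not be measurable. *)
pose rep (j : J) : option (distr R) :=
  if pselect (exists F, B F /\ idx F = j) is left H then Some (projT1 (cid H)) else None.
have repP j G : rep j = Some G -> B G /\ idx G = j.
  by rewrite /rep; case: pselect => // H [<-]; exact: (projT2 (cid H)).
have repB F : B F -> exists G, rep (idx F) = Some G.
  by move=> BF; rewrite /rep; case: pselect => [H|[]]; [eexists|exists F].
pose E (j : J) : set Om := if rep j is Some G then
  [set w | s < \prod_(i < n) Num.sqrt (mix_ratio Fs G (X i w))] else set0.
have mE j : measurable (E j).
  rewrite /E; case: (rep j) => // G.
  have mf : measurable_fun [set: Om] (fun w => \prod_(i < n) Num.sqrt (mix_ratio Fs G (X i w))).
    by apply: measurable_prod => i _; exact: (measurableT_comp (measurable_sqrt_ratio G)).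
  rewrite (_ : [set w | _] = (fun w => \prod_(i < n) Num.sqrt (mix_ratio Fs G (X i w))) @^-1`
      `]s, +oo[%classic); last first.
    by apply/seteqP; split => w /=; rewrite in_itv/= andbT.
  by rewrite -[X in measurable X]setTI; apply: mf.
have PE j : (P (E j) <= s%:E)%E.
  rewrite /E; case repj : (rep j) => [G|]; last by rewrite measure0 lee_fin ltW.
  have [BG _] := repP _ _ repj.
  apply: le_trans (sqrt_likelihood_ratio_deviation n (BM _ BG) s0) _.
  rewrite lee_fin /s -expRN -expRD ler_expR; have := dB _ BG.
  by set q := n%:R * _; lra.
pose A (i : nat) := [set w | L < `|X i w|].
have mA i : measurable (A i).
  have mT : measurable [set x : R | L < `|x|].
    rewrite (_ : [set x | _] = (fun x : R => `|x|) @^-1` `]L, +oo[%classic); last first.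
      by apply/seteqP; split => x /=; rewrite in_itv/= andbT.
    by rewrite -[X in measurable X]setTI; apply: normr_measurable.
  rewrite (_ : A i = X i @^-1` [set x : R | L < `|x|])//.
  by rewrite -[X in measurable X]setTI; exact: (measurable_funP (X i)).
pose bad := \big[setU/set0]_(i < n) A i `|` \big[setU/set0]_(j : J) E j.
have mbad : measurable bad.
  by apply: measurableU; apply: bigsetU_measurable.
apply: (@le_trans _ _ (P bad)).
  apply: le_measure; rewrite ?inE//.
    have mpost : measurable_fun [set: Om]
        (fun w => `|posterior M Pi n (fun i => X i w) B - 0|).
      apply: measurableT_comp => //; apply: measurable_funB => //.
      exact: measurable_posterior.
    rewrite (_ : [set w | _] = (fun w => `|posterior M Pi n (fun i => X i w) B - 0|)
       @^-1` `]eps, +oo[%classic); last first.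
      by apply/seteqP; split => w /=; rewrite in_itv/= andbT.
    by rewrite -[X in measurable X]setTI; apply: mpost.
  move=> w /= epsw; apply: contrapT => nbad.
  have Xw i : (i < n)%N -> `|X i w| <= L.
    move=> ni; rewrite leNgt; apply/negP => Lw; apply: nbad; left.
    by rewrite -(bigcup_mkord n A); exists i.
  have Ew j G : rep j = Some G ->
      \prod_(i < n) Num.sqrt (mix_ratio Fs G (X i w)) <= s.
    move=> repj; rewrite leNgt; apply/negP => sw; apply: nbad; right.
    rewrite -bigcup_seq; exists j => //=; first by rewrite mem_index_enum.
    by rewrite /E repj.
  move: epsw; rewrite subr0 ger0_norm ?posterior_ge0//; apply/negP; rewrite -leNgt.
  (* One factor e is the passage from F to its representative, the other from [Fs] to the members of
     [V]; the quotient is by the prior mass of [V]. *)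
  apply: (@le_trans _ _ (expR 1 * s ^+ 2 * expR 1 / expR (- (C2 * L ^+ 2)))).
    apply: (posterior_le M_gt0 FsM mB BM mV VM _ (expR_gt0 1) (expR_gt0 _) PiV).
    - by rewrite mulr_ge0 ?expR_ge0 ?sqr_ge0.
    - move=> F BF; have [G repF] := repB F BF.
      have [BG GF] := repP _ _ repF.
      have GM := BM _ BG.
      apply: (@le_trans _ _ (expR 1 * likelihood n (fun i => X i w) G)).
        apply: (likelihood_close GM n0 Ln) => i ni.
        by apply: Hidx => //; [exact: BM|exact: Xw].
      rewrite -mulrA ler_wpM2l ?expR_ge0//.
      have -> : likelihood n (fun i => X i w) G =
          (\prod_(i < n) Num.sqrt (mix_ratio Fs G (X i w))) ^+ 2 *
          likelihood n (fun i => X i w) Fs.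
        rewrite -prodrXl -big_split/=; apply: eq_bigr => i _.
        rewrite sqr_sqrtr ?(ltW (mix_ratio_gt0 M_gt0 Fs_min _ GM))//.
        by rewrite /mix_ratio divfK// gt_eqF// (mix_pdf_gt0 M_gt0).
      rewrite ler_wpM2r ?likelihood_ge0// lerXn2r ?nnegrE ?(ltW s0)//.
        by apply: prodr_ge0 => i _; exact: sqrtr_ge0.
      exact: Ew repF.
    - move=> F VF; apply: (likelihood_close (VM _ VF) n0 Ln) => i ni.
      by apply: HV => //; exact: Xw.
  apply: le_trans Heps; rewrite /s -expRN -expRM_natl -!expRD ler_expR.
  by rewrite le_eqVlt; apply/orP; left; apply/eqP; field.
apply: le_trans (measureU2 _ _ _) _; [exact: bigsetU_measurable|exact: bigsetU_measurable|].
rewrite EFinD; apply: leeD; first exact: max_deviation.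
apply: le_trans (measure_bigsetU_le _ _ _) _ => //.
apply: (@le_trans _ _ (\sum_(j : J) s%:E)%E); first by apply: lee_sum => j _; exact: PE.
rewrite sumEFin lee_fin sumr_const -[leLHS]mulr_natl.
apply: (@le_trans _ _ (expR (C1 * L ^+ 2) * s)).
  by rewrite ler_wpM2r// ltW.
by rewrite /s -expRD ler_expR le_eqVlt; apply/orP; left; apply/eqP; field.
Qed.

End deviation.

Theorem theorem3p2 (R : realType) (M : R) (M_gt0 : 0 < M)
  (P0 : distr R) (p0 : R -> R) (P0_density : has_density P0 p0)
  (kl_finite : exists2 F : distr R, distr_on M F & (kl_loss P0 p0 F < +oo)%E)
  (Fs : distr R) (Fs_min : is_kl_minimizer M P0 p0 Fs)
  (p0_bounded : (fun x => p0 x / mix_pdf Fs x)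
                  \in Lfun (@lebesgue_measure R) +oo%E)
  (alpha : {finite_measure set (measurableTypeR R) -> \bar R}) (a : R -> R)
  (a_continuous : {within `[- M, M]%classic, continuous a})
  (a_gt0 : forall x, x \in `[- M, M] -> 0 < a x)
  (alpha_density : forall A : set R, measurable A ->
     alpha A = (\int[@lebesgue_measure R]_(x in A `&` `[(- M)%R, M])
                  (a x)%:E)%E)
  (Pi : probability (distr R) R) (Pi_DP : dirichlet_process M alpha Pi)
  (d : measure_display) (Om : measurableType d) (P : probability Om R)
  (X : nat -> {RV P >-> R}) (X_iid : iid X P0)
  (K : nat -> R) (K_infty : K @ \oo --> +oo) :
  cvg_in_probability P
    (fun n w => posterior M Pi n (fun i => X i w)
       [set F | distr_on M F /\
          K n * (ln n%:R / Num.sqrt n%:R) < weighted_hellinger p0 Fs F Fs])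
    0.
Proof.
have FsM : distr_on M Fs by case: Fs_min.
have [C3 C30 HC3] := tail_bound M_gt0 P0_density Fs_min p0_bounded.
have [C2 C20 HC2] := exists_prior_ball M_gt0 a_continuous a_gt0 alpha_density Pi_DP FsM.
have C10 : 0 <= covering_rate M.
  have := moment_rate_gt0 M_gt0; have := degree_rate_gt0 M_gt0.
  by move=> d0 m0; rewrite /covering_rate mulr_ge0//; lra.
set C1 := covering_rate M in C10.
move=> eps eps0.
(* Once K n >= k0 >= 2, (K n)^2 >= 2 k0, which brings both C1 - (K n)^2 / 2 and C2 - (K n)^2 below -
   1. *)
pose k0 := 2 * C1 + 2 * C2 + 2.
have ubound : \forall n \near \oo, (0 <= P [set w | (eps < `|posterior M Pi n (fun i => X i w)
       [set F | distr_on M F /\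
          (K n * (ln n%:R / Num.sqrt n%:R) < weighted_hellinger p0 Fs F Fs)%R] - 0|)%R]
    <= ((2 * (C3 + 1)) * harmonic n)%:E)%E.
  near=> n.
  have n3 : expR 1 <= n%:R :> R.
    by near: n; exact: nbhs_infty_ger.
  (* Makes the bound exp(2 - L) = e^2 / n on the posterior mass at most [eps]. *)
  have neps : expR 2 / eps <= n%:R by near: n; exact: nbhs_infty_ger.
  have kn : k0 <= K n by near: n; move/cvgryPge : K_infty; exact.
  have nR0 : 0 < n%:R :> R by apply: lt_le_trans n3; exact: expR_gt0.
  have n0 : (0 < n)%N by rewrite -(ltr0n R).
  pose L : R := ln n%:R.
  have Ln : expR L = n%:R by rewrite /L lnK.
  have L1 : 1 <= L by rewrite -ler_expR Ln.
  have [J [idx [HJ Hidx]]] := exists_covering M_gt0 L1.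
  have [V [mV VM PiV HV]] := HC2 L L1.
  have k2 : 2 * k0 <= K n ^+ 2 by rewrite /k0 in kn *; nra.
  have L2 : L <= L ^+ 2 by rewrite expr2; nra.
  have Heps : expR (2 + (C2 - K n ^+ 2) * L ^+ 2) <= eps.
    apply: (@le_trans _ _ (expR (2 - L))).
      by rewrite ler_expR; rewrite /k0 in k2; nra.
    by rewrite expRB Ln ler_pdivrMr// mulrC -ler_pdivrMr.
  apply/andP; split; first exact: measure_ge0.
  have k00 : 0 <= K n by apply: le_trans kn; rewrite /k0; lra.
  have L0 : 0 <= L by lra.
  apply: le_trans (posterior_deviation M_gt0 P0_density Fs_min p0_bounded X_iid
    n0 Ln k00 L0 HC3 HJ Hidx mV VM PiV HV Heps) _.
  rewrite lee_fin.
  apply: (@le_trans _ _ ((C3 + 1) * n%:R^-1)).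
    rewrite [leRHS]mulrDl mul1r -Ln -expRN lerD2l ler_expR.
    have h : C1 - K n ^+ 2 / 2 <= - 1 by rewrite /k0 in k2; lra.
    by have := ler_wpM2r (sqr_ge0 L) h; rewrite -/C1; lra.
  rewrite [2 * _]mulrC -mulrA ler_wpM2l//; first by lra.
  (* [harmonic n] is 1/(n + 1), which accounts for the factor 2. *)
  rewrite /harmonic/= -[leLHS]mul1r ler_pdivrMr// mulrAC ler_pdivlMr ?ltr0n//.
  have n1 : 1 <= n%:R :> R by rewrite ler1n.
  by rewrite mul1r -(natr1 n); lra.
apply: (squeeze_cvge ubound); first exact: cvg_cst.
rewrite -[X in _ --> X]/(0%:E) -[X in X%:E](mulr0 (2 * (C3 + 1))).
apply: cvg_EFin; first exact: nearW.
by apply: cvgM; [exact: cvg_cst|exact: cvg_harmonic].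
Unshelve. all: by end_near.
Qed.
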